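(* Let $\varphi\in[0,2\pi)$ and let $L$ be a normal operator on $\mathbb{C}^2\otimes\mathbb{C}^2$. Then the single Lindblad operator $L$ enforces nontrivial phase-locking with phase shift $\varphi$ (as defined in the context) if and only if there is $u\in\mathbb{C}$ with $|u|=1$ such that at least one of the following holds (matrices in the ordered basis $(|00\rangle,|01\rangle,|10\rangle,|11\rangle)$): (1) $uL=T_1\begin{pmatrix} c&0&0&0\\ 0&c&0&0\\ 0&0&a&b\\ 0&0&e^{2ik}\bar b&a+me^{ik}\end{pmatrix}T_1^\dagger$ with $T_1=\begin{pmatrix}1&0&0&0\\ 0&\frac1{\sqrt2}&\frac1{\sqrt2}&0\\ 0&\frac{e^{i\varphi}}{\sqrt2}&-\frac{e^{i\varphi}}{\sqrt2}&0\\ 0&0&0&1\end{pmatrix}$, for some $a,b\in\mathbb{C}$, $c,k,m\in\mathbb{R}$ satisfying $b\neq0$ or ($a\neq c$ and $m\neq0$); (2) $uL=T_2\begin{pmatrix} a&b&0&0\\ e^{2ik}\bar b&a+me^{ik}&0&0\\ 0&0&c&0\\ 0&0&0&c\end{pmatrix}T_2^\dagger$ with $T_2=\begin{pmatrix}1&0&0&0\\ 0&\frac1{\sqrt2}&\frac1{\sqrt2}&0\\ 0&-\frac{e^{i\varphi}}{\sqrt2}&\frac{e^{i\varphi}}{\sqrt2}&0\\ 0&0&0&1\end{pmatrix}$, for some $a,b\in\mathbb{C}$, $c,k,m\in\mathbb{R}$ satisfying $b\neq0$ or ($a+me^{ik}\neq c$ and $m\neq0$); (3) for some $\theta\in(-\frac\pi2,0)\cup(0,\frac\pi2)$,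 $uL=T_\theta\begin{pmatrix} a&b&0&0\\ e^{2ik}\bar b&a+me^{ik}&0&0\\ 0&0&a&e^{-2i\theta}b\\ 0&0&e^{2i\theta}e^{2ik}\bar b&a+me^{ik}\end{pmatrix}T_\theta^\dagger$ with $T_\theta=\begin{pmatrix}1&0&0&0\\ 0&ie^{-i\varphi}\sin\theta&\cos\theta&0\\ 0&-\cos\theta&-ie^{i\varphi}\sin\theta&0\\ 0&0&0&1\end{pmatrix}$, for some $a,b\in\mathbb{C}$, $k,m\in\mathbb{R}$ with $b\neq0$.
   Context: Two qubits $A$ (first factor) and $B$ (second factor), Hilbert space $\mathscr H=\mathbb{C}^2\otimes\mathbb{C}^2$, $|ij\rangle=|i\rangle\otimes|j\rangle$. The free Hamiltonian is $H=H_0\otimes I+I\otimes H_0$ with $H_0=\mathrm{diag}(E_0,E_1)$ in the basis $(|0\rangle,|1\rangle)$, $E_0,E_1\in\mathbb{R}$, $\Delta E=E_0-E_1\neq0$. For an operator $L$, the generator is $\mathcal L(\rho)=-i[H,\rho]+L\rho L^\dagger-\frac12\{L^\dagger L,\rho\}$ on operators on $\mathscr H$, and $\mathcal T_t=e^{t\mathcal L}$. The attractor space $\mathrm{Att}(\mathcal T)$ is the direct sum of $\ker(\mathcal L-\lambda I)$ over all purely imaginary eigenvalues $\lambda$ (including $0$) of $\mathcal L$. Put $X_{\Delta E}=\mathrm{span}\{|00\rangle\langle01|,|00\rangle\langle10|,|01\rangle\langle11|,|10\rangle\langle11|\}$ (operators $X$ with $[H,X]=\Delta E\,X$); together with the adjoints,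 these are the only attractor components contributing to non-stationary reduced dynamics. $\mathrm{Tr}_A$, $\mathrm{Tr}_B$ denote partial traces over the first and second factor. The Lindblad operator $L$ enforces nontrivial phase-locking with phase shift $\varphi$ if $\mathrm{Tr}_A X=e^{i\varphi}\,\mathrm{Tr}_B X$ for every $X\in\mathrm{Att}(\mathcal T)\cap X_{\Delta E}$ and there is at least one such $X$ with $\mathrm{Tr}_B X\neq 0$ (i.e. the asymptotic reduced dynamics is not always stationary). *)

(* Defs.v *)
(* Operators on the two-qubit space C^2 (x) C^2 are matrices over R[i] indexed
   by 'I_(2 * 2); mxtens_index (i, j) = 2 * i + j, so the indices 0, 1, 2, 3 are
   the basis vectors |00>, |01>, |10>, |11> in this order. *)
From mathcomp Require Import all_boot all_order all_algebra.
From mathcomp Require Import reals trigo.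
From mathcomp Require Import complex mxtens.

Set Implicit Arguments.
Unset Strict Implicit.
Unset Printing Implicit Defensive.

Import Order.TTheory GRing.Theory Num.Theory.
Local Open Scope ring_scope.
Local Open Scope sesquilinear_scope.

Notation op1 R := 'M[R[i]]_2.
Notation op2 R := 'M[R[i]]_(2 * 2).

Definition expi (R : realType) (x : R) : R[i] := Complex (cos x) (sin x).

Definition mx_of_rows (T : nzRingType) (m n : nat) (rows : seq (seq T)) :
  'M[T]_(m, n) := \matrix_(i < m, j < n) (nth [::] rows i)`_j.

Definition ket (R : realType) (i j : 'I_2) : 'M[R[i]]_(2 * 2, 1 * 1) :=
  (delta_mx i 0 : 'cV[R[i]]_2) *t (delta_mx j 0 : 'cV[R[i]]_2).

Definition ketbra (R : realType) (i j k l : 'I_2) : op2 R :=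
  ket R i j *m (ket R k l)^t*.

Definition free_ham1 (R : realType) (E0 E1 : R) : op1 R :=
  mx_of_rows 2 2 [:: [:: real_complex R E0; 0]; [:: 0; real_complex R E1]].

Definition free_ham (R : realType) (E0 E1 : R) : op2 R :=
  free_ham1 E0 E1 *t (1%:M : op1 R) + (1%:M : op1 R) *t free_ham1 E0 E1.

Definition commutator (R : realType) (A B : op2 R) : op2 R := A *m B - B *m A.
Definition anticommutator (R : realType) (A B : op2 R) : op2 R :=
  A *m B + B *m A.

Definition lindbladian (R : realType) (H L rho : op2 R) : op2 R :=
  (- 'i) *: commutator H rho + L *m rho *m L^t*
  - 2^-1 *: anticommutator (L^t* *m L) rho.

(* X is a finite sum of elements of ker (lindbladian - 'i w), for pairwise
   distinct real w; a w for which 'i w is not an eigenvalue contributes 0. *)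
Definition attractor (R : realType) (H L X : op2 R) : Prop :=
  exists (ws : seq R) (Y : R -> op2 R),
    [/\ uniq ws,
        forall w, w \in ws ->
          lindbladian H L (Y w) = ('i * real_complex R w) *: Y w
      & X = \sum_(w <- ws) Y w].

Definition X_DeltaE (R : realType) : {vspace op2 R} :=
  <<[:: ketbra R 0 0 0 1; ketbra R 0 0 1 0;
        ketbra R 0 1 1 1; ketbra R 1 0 1 1]%R>>%VS.

Definition ptraceA (R : realType) (X : op2 R) : op1 R :=
  \matrix_(i, j) \sum_(k < 2) X (mxtens_index (k, i)) (mxtens_index (k, j)).
Definition ptraceB (R : realType) (X : op2 R) : op1 R :=
  \matrix_(i, j) \sum_(k < 2) X (mxtens_index (i, k)) (mxtens_index (j, k)).

Definition enforces_phase_locking (R : realType) (E0 E1 : R) (L : op2 R)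
    (phi : R) : Prop :=
  (forall X, attractor (free_ham E0 E1) L X -> X \in X_DeltaE R ->
     ptraceA X = expi phi *: ptraceB X) /\
  (exists X, [/\ attractor (free_ham E0 E1) L X, X \in X_DeltaE R
               & ptraceB X <> 0]).

Definition T1 (R : realType) (phi : R) : op2 R :=
  let s := real_complex R (Num.sqrt 2)^-1 in
  let e := expi phi in
  mx_of_rows (2 * 2) (2 * 2)
    [:: [:: 1; 0; 0; 0];
        [:: 0; s; s; 0];
        [:: 0; e * s; - (e * s); 0];
        [:: 0; 0; 0; 1]].

Definition T2 (R : realType) (phi : R) : op2 R :=
  let s := real_complex R (Num.sqrt 2)^-1 in
  let e := expi phi in
  mx_of_rows (2 * 2) (2 * 2)
    [:: [:: 1; 0; 0; 0];
        [:: 0; s; s; 0];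
        [:: 0; - (e * s); e * s; 0];
        [:: 0; 0; 0; 1]].

Definition Ttheta (R : realType) (phi theta : R) : op2 R :=
  let st := real_complex R (sin theta) in
  let ct := real_complex R (cos theta) in
  mx_of_rows (2 * 2) (2 * 2)
    [:: [:: 1; 0; 0; 0];
        [:: 0; 'i * expi (- phi) * st; ct; 0];
        [:: 0; - ct; - ('i * expi phi * st); 0];
        [:: 0; 0; 0; 1]].

Definition L1_core (R : realType) (a b : R[i]) (c k m : R) : op2 R :=
  let cc := real_complex R c in
  mx_of_rows (2 * 2) (2 * 2)
    [:: [:: cc; 0; 0; 0];
        [:: 0; cc; 0; 0];
        [:: 0; 0; a; b];
        [:: 0; 0; expi (2 * k) * b^*; a + real_complex R m * expi k]].

Definition L2_core (R : realType) (a b : R[i]) (c k m : R) : op2 R :=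
  let cc := real_complex R c in
  mx_of_rows (2 * 2) (2 * 2)
    [:: [:: a; b; 0; 0];
        [:: expi (2 * k) * b^*; a + real_complex R m * expi k; 0; 0];
        [:: 0; 0; cc; 0];
        [:: 0; 0; 0; cc]].

Definition L3_core (R : realType) (theta : R) (a b : R[i]) (k m : R) : op2 R :=
  let d := a + real_complex R m * expi k in
  mx_of_rows (2 * 2) (2 * 2)
    [:: [:: a; b; 0; 0];
        [:: expi (2 * k) * b^*; d; 0; 0];
        [:: 0; 0; a; expi (- 2 * theta) * b];
        [:: 0; 0; expi (2 * theta) * expi (2 * k) * b^*; d]].

(* Main.v *)
(* A trace identity shows that every peripheral eigenvector of the generator
   commutes with the normal operator L, so the attractors lying in X_DeltaE are
   exactly the X = |00><v| + |w><11|, with v and w in span {|01>, |10>}, which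
   commute with L, hence also with its adjoint.  If one such X has w = 0, the
   locking condition forces v to be proportional to |01> + e^{i phi}|10>, and L
   has form (1); if one has v = 0, L has form (2).  Otherwise X X^* X and X^* X X
   also commute with L, which forces |v| = |w| and <v, w> = 0: then |00>, w, v,
   |11> is an orthogonal basis, L acts in the same way on span {|00>, w} and
   span {v, |11>}, and this is form (3).  A normal 2 x 2 matrix [a, b; b', d]
   satisfies |b'| = |b| and (a - d) b'^* = (a - d)^* b, which gives the
   parameters k and m. *)
Require Import Defs.
From mathcomp Require Import all_boot all_order all_algebra.
From mathcomp Require Import reals trigo.
From mathcomp Require Import complex mxtens.
From mathcomp Require Import ring.

Import Order.TTheory GRing.Theory Num.Theory.
Local Open Scope ring_scope.
Local Open Scope sesquilinear_scope.

Set Implicit Arguments.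
Unset Strict Implicit.

(** * Entrywise calculus of 4 x 4 matrices *)

Definition op4 (C : nzRingType) (a00 a01 a02 a03 a10 a11 a12 a13
    a20 a21 a22 a23 a30 a31 a32 a33 : C) : 'M[C]_(2 * 2) :=
  mx_of_rows (2 * 2) (2 * 2)
    [:: [:: a00; a01; a02; a03]; [:: a10; a11; a12; a13];
        [:: a20; a21; a22; a23]; [:: a30; a31; a32; a33]].

(** The index stays an explicit [Ordinal h], so that once its value is rewritten the entry lookups
    in [op4] reduce by computation. *)
Lemma ord4P (P : 'I_(2 * 2) -> Prop) :
  (forall k (h : (k < 4)%N), (k = 0 \/ k = 1 \/ k = 2 \/ k = 3)%N ->
     P (Ordinal h)) -> forall i, P i.
Proof.
move=> H [k h]; apply: (H k h).
by move: k h => [|[|[|[|k]]]] //= _; auto.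
Qed.

Lemma op4E (C : nzRingType) (A : 'M[C]_(2 * 2)) :
  exists a00 a01 a02 a03 a10 a11 a12 a13 a20 a21 a22 a23 a30 a31 a32 a33,
  A = op4 a00 a01 a02 a03 a10 a11 a12 a13 a20 a21 a22 a23 a30 a31 a32 a33.
Proof.
pose o k h : 'I_(2 * 2) := @Ordinal 4 k h.
pose o0 := o 0 isT; pose o1 := o 1 isT; pose o2 := o 2 isT; pose o3 := o 3 isT.
exists (A o0 o0), (A o0 o1), (A o0 o2), (A o0 o3),
  (A o1 o0), (A o1 o1), (A o1 o2), (A o1 o3),
  (A o2 o0), (A o2 o1), (A o2 o2), (A o2 o3),
  (A o3 o0), (A o3 o1), (A o3 o2), (A o3 o3).
apply/matrixP; apply: ord4P => i hi Hi; apply: ord4P => j hj Hj; rewrite mxE.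
by move: Hi Hj hi hj => [|[|[|]]] -> [|[|[|]]] -> hi hj; congr (A _ _); exact: val_inj.
Qed.

Section Op4.
Variable C : numClosedFieldType.
Variables a00 a01 a02 a03 a10 a11 a12 a13 a20 a21 a22 a23 a30 a31 a32 a33 : C.
Variables b00 b01 b02 b03 b10 b11 b12 b13 b20 b21 b22 b23 b30 b31 b32 b33 : C.
Let A := op4 a00 a01 a02 a03 a10 a11 a12 a13 a20 a21 a22 a23 a30 a31 a32 a33.
Let B := op4 b00 b01 b02 b03 b10 b11 b12 b13 b20 b21 b22 b23 b30 b31 b32 b33.

Lemma op4_inj : A = B ->
  ((a00 = b00) * (a01 = b01) * (a02 = b02) * (a03 = b03)) *
  ((a10 = b10) * (a11 = b11) * (a12 = b12) * (a13 = b13)) *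
  ((a20 = b20) * (a21 = b21) * (a22 = b22) * (a23 = b23)) *
  ((a30 = b30) * (a31 = b31) * (a32 = b32) * (a33 = b33)).
Proof.
move=> /matrixP e.
have E i j (hi : (i < 4)%N) (hj : (j < 4)%N) := e (@Ordinal 4 i hi) (@Ordinal 4 j hj).
do !split.
- by move: (E 0 0 isT isT); rewrite !mxE.
- by move: (E 0 1 isT isT); rewrite !mxE.
- by move: (E 0 2 isT isT); rewrite !mxE.
- by move: (E 0 3 isT isT); rewrite !mxE.
- by move: (E 1 0 isT isT); rewrite !mxE.
- by move: (E 1 1 isT isT); rewrite !mxE.
- by move: (E 1 2 isT isT); rewrite !mxE.
- by move: (E 1 3 isT isT); rewrite !mxE.
- by move: (E 2 0 isT isT); rewrite !mxE.
- by move: (E 2 1 isT isT); rewrite !mxE.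
- by move: (E 2 2 isT isT); rewrite !mxE.
- by move: (E 2 3 isT isT); rewrite !mxE.
- by move: (E 3 0 isT isT); rewrite !mxE.
- by move: (E 3 1 isT isT); rewrite !mxE.
- by move: (E 3 2 isT isT); rewrite !mxE.
- by move: (E 3 3 isT isT); rewrite !mxE.
Qed.

Lemma mul_op4 : A *m B = op4
  (a00 * b00 + a01 * b10 + a02 * b20 + a03 * b30)
  (a00 * b01 + a01 * b11 + a02 * b21 + a03 * b31)
  (a00 * b02 + a01 * b12 + a02 * b22 + a03 * b32)
  (a00 * b03 + a01 * b13 + a02 * b23 + a03 * b33)
  (a10 * b00 + a11 * b10 + a12 * b20 + a13 * b30)
  (a10 * b01 + a11 * b11 + a12 * b21 + a13 * b31)
  (a10 * b02 + a11 * b12 + a12 * b22 + a13 * b32)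
  (a10 * b03 + a11 * b13 + a12 * b23 + a13 * b33)
  (a20 * b00 + a21 * b10 + a22 * b20 + a23 * b30)
  (a20 * b01 + a21 * b11 + a22 * b21 + a23 * b31)
  (a20 * b02 + a21 * b12 + a22 * b22 + a23 * b32)
  (a20 * b03 + a21 * b13 + a22 * b23 + a23 * b33)
  (a30 * b00 + a31 * b10 + a32 * b20 + a33 * b30)
  (a30 * b01 + a31 * b11 + a32 * b21 + a33 * b31)
  (a30 * b02 + a31 * b12 + a32 * b22 + a33 * b32)
  (a30 * b03 + a31 * b13 + a32 * b23 + a33 * b33).
Proof.
apply/matrixP; apply: ord4P => i hi Hi; apply: ord4P => j hj Hj.
rewrite !mxE !big_ord_recl big_ord0 !mxE addr0 !addrA.
by move: Hi Hj hi hj => [|[|[|]]] -> [|[|[|]]] -> hi hj.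
Qed.

Lemma adj_op4 : A^t* = op4 a00^* a10^* a20^* a30^* a01^* a11^* a21^* a31^*
  a02^* a12^* a22^* a32^* a03^* a13^* a23^* a33^*.
Proof.
apply/matrixP; apply: ord4P => i hi Hi; apply: ord4P => j hj Hj; rewrite !mxE.
by move: Hi Hj hi hj => [|[|[|]]] -> [|[|[|]]] -> hi hj.
Qed.

Lemma scale_op4 (x : C) : x *: A = op4
  (x * a00) (x * a01) (x * a02) (x * a03) (x * a10) (x * a11) (x * a12) (x * a13)
  (x * a20) (x * a21) (x * a22) (x * a23) (x * a30) (x * a31) (x * a32) (x * a33).
Proof.
apply/matrixP; apply: ord4P => i hi Hi; apply: ord4P => j hj Hj; rewrite !mxE.
by move: Hi Hj hi hj => [|[|[|]]] -> [|[|[|]]] -> hi hj.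
Qed.

Lemma sub_op4 : A - B = op4
  (a00 - b00) (a01 - b01) (a02 - b02) (a03 - b03)
  (a10 - b10) (a11 - b11) (a12 - b12) (a13 - b13)
  (a20 - b20) (a21 - b21) (a22 - b22) (a23 - b23)
  (a30 - b30) (a31 - b31) (a32 - b32) (a33 - b33).
Proof.
apply/matrixP; apply: ord4P => i hi Hi; apply: ord4P => j hj Hj; rewrite !mxE.
by move: Hi Hj hi hj => [|[|[|]]] -> [|[|[|]]] -> hi hj.
Qed.
End Op4.

Lemma op4_1 (C : numClosedFieldType) :
  1%:M = op4 (1 : C) 0 0 0 0 1 0 0 0 0 1 0 0 0 0 1.
Proof.
apply/matrixP; apply: ord4P => i hi Hi; apply: ord4P => j hj Hj; rewrite !mxE.
by move: Hi Hj hi hj => [|[|[|]]] -> [|[|[|]]] -> hi hj.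
Qed.

(** * Hilbert-Schmidt norms of commutators *)

Lemma tr_adj_eq0 (C : numClosedFieldType) n (A : 'M[C]_n) :
  \tr (A^t* *m A) = 0 -> A = 0.
Proof.
move=> h; apply/matrixP => i j; rewrite mxE; move: h; rewrite /mxtrace.
under eq_bigr do rewrite mxE.
rewrite exchange_big => h.
have h1 : forall k l, 0 <= (A^t*) l k * A k l by move=> k l; rewrite !mxE -normCKC exprn_ge0.
have h2 k : 0 <= \sum_l (A^t*) l k * A k l by apply: sumr_ge0.
have h3 : \sum_l (A^t*) l i * A i l = 0 by apply: (psumr_eq0P _ h).
have := psumr_eq0P _ h3 => /(_ (fun l _ => h1 i l)) /(_ j isT).
by rewrite !mxE -normCKC => /eqP; rewrite sqrf_eq0 normr_eq0 => /eqP.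
Qed.

Lemma adj_mul (C : numClosedFieldType) m n p (A : 'M[C]_(m, n)) (B : 'M[C]_(n, p)) :
  (A *m B)^t* = B^t* *m A^t*.
Proof. by rewrite trmx_mul map_mxM. Qed.

Lemma adj_sub (C : numClosedFieldType) m n (A B : 'M[C]_(m, n)) :
  (A - B)^t* = A^t* - B^t*.
Proof. by rewrite linearB /= map_mxB. Qed.

Lemma tr_adj (C : numClosedFieldType) n (A : 'M[C]_n) : \tr (A^t*) = (\tr A)^*.
Proof. by rewrite /mxtrace rmorph_sum; apply: eq_bigr => i _; rewrite !mxE. Qed.

(** Expansion of the squared Hilbert-Schmidt norm of [L, X], with cyclicity of the trace bringing
    the terms to the shape in which the dissipator produces them. *)
Lemma tr_comm_adj (C : numClosedFieldType) n (L X : 'M[C]_n) :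
  \tr ((L *m X - X *m L)^t* *m (L *m X - X *m L)) =
  \tr (X^t* *m L^t* *m L *m X) + \tr (X^t* *m X *m L *m L^t*)
  - \tr (L *m X^t* *m L^t* *m X) - \tr (X^t* *m L *m X *m L^t*).
Proof.
have c1 : \tr (X^t* *m L^t* *m X *m L) = \tr (L *m X^t* *m L^t* *m X).
  by rewrite mxtrace_mulC !mulmxA.
have c2 : \tr (L^t* *m X^t* *m L *m X) = \tr (X^t* *m L *m X *m L^t*).
  by rewrite -!mulmxA mxtrace_mulC -!mulmxA.
have c3 : \tr (L^t* *m X^t* *m X *m L) = \tr (X^t* *m X *m L *m L^t*).
  by rewrite -!mulmxA mxtrace_mulC -!mulmxA.
rewrite adj_sub !adj_mul mulmxBl !mulmxBr !mulmxA !(raddfB (@mxtrace C n)) /=.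
rewrite c1 c2 c3; ring.
Qed.

(** Fuglede's theorem in finite dimension: for normal L the commutators of X with L and with its
    adjoint have the same Hilbert-Schmidt norm. *)
Lemma normal_comm_adj (C : numClosedFieldType) n (L X : 'M[C]_n) :
  L \is normalmx -> L *m X = X *m L -> L^t* *m X = X *m L^t*.
Proof.
move=> /normalmxP nL cLX; apply/eqP; rewrite -subr_eq0; apply/eqP.
apply: tr_adj_eq0; have := tr_comm_adj L X.
rewrite cLX subrr mulmx0 mxtrace0 tr_comm_adj trmxCK => h.
have c1 : \tr (L^t* *m X^t* *m L *m X) = \tr (X^t* *m L *m X *m L^t*).
  by rewrite -!mulmxA mxtrace_mulC -!mulmxA.
have c2 : \tr (X^t* *m L^t* *m X *m L) = \tr (L *m X^t* *m L^t* *m X).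
  by rewrite mxtrace_mulC !mulmxA.
(* [h] replaces the right-hand 0 by the expansion for L, so that two expansions are left to
   compare. *)
rewrite c1 c2 h.
have c3 : X^t* *m L *m L^t* = X^t* *m L^t* *m L by rewrite -!mulmxA nL.
have c4 : X^t* *m X *m L^t* *m L = X^t* *m X *m L *m L^t* by rewrite -!mulmxA nL.
rewrite c3 c4; ring.
Qed.

(** The Hamiltonian part of z is purely imaginary and cancels in z + z^*, which leaves t + t' - (q1
    + q2). *)
Lemma dissipation_eq (C : numClosedFieldType) (h1 h2 t t' q1 q2 z : C) :
  h1^* = h1 -> h2^* = h2 -> t^* = t' -> q1^* = q1 -> q2^* = q2 ->
  z = - 'i * (h1 - h2) + t - 2^-1 * (q1 + q2) -> z + z^* = 0 ->
  q1 + q2 - t - t' = 0.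
Proof.
move=> eh1 eh2 et eq1 eq2 ->.
rewrite rmorphB rmorphD /= [('i in X in X * _)]lock.
rewrite !rmorphM /= rmorphB rmorphD /= fmorphV rmorph_nat.
rewrite -lock rmorphN /= conjCi eh1 eh2 et eq1 eq2 => e.
have {1}-> : q1 + q2 - t - t' = - (- 'i * (h1 - h2) + t - 2^-1 * (q1 + q2) +
   (- - 'i * (h1 - h2) + t' - 2^-1 * (q1 + q2))) by field.
by rewrite e oppr0.
Qed.

(** Here z is the pairing of Y with its image under the generator. By normality of L, z + z^* is
    minus the squared norm of [L, Y], so a purely imaginary z forces the commutator to vanish. *)
Lemma comm_of_dissipation_free (C : numClosedFieldType) n (H L Y : 'M[C]_n) z :
  H^t* = H -> L \is normalmx ->
  z = - 'i * (\tr (Y^t* *m H *m Y) - \tr (Y^t* *m Y *m H))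
    + \tr (Y^t* *m L *m Y *m L^t*)
    - 2^-1 * (\tr (Y^t* *m L^t* *m L *m Y) + \tr (Y^t* *m Y *m L^t* *m L)) ->
  z + z^* = 0 -> L *m Y = Y *m L.
Proof.
move=> hH /normalmxP nL d e; apply/eqP; rewrite -subr_eq0; apply/eqP.
apply: tr_adj_eq0; rewrite tr_comm_adj.
have tJ (A : 'M[C]_n) : (\tr A)^* = \tr (A^t*) by rewrite tr_adj.
have j1 : (\tr (Y^t* *m H *m Y))^* = \tr (Y^t* *m H *m Y).
  by rewrite tJ !adj_mul trmxCK hH !mulmxA.
have j2 : (\tr (Y^t* *m Y *m H))^* = \tr (Y^t* *m Y *m H).
  by rewrite tJ !adj_mul trmxCK hH mxtrace_mulC.
have j3 : (\tr (Y^t* *m L *m Y *m L^t*))^* = \tr (L *m Y^t* *m L^t* *m Y).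
  by rewrite tJ !adj_mul !trmxCK !mulmxA.
have j4 : (\tr (Y^t* *m L^t* *m L *m Y))^* = \tr (Y^t* *m L^t* *m L *m Y).
  by rewrite tJ !adj_mul !trmxCK !mulmxA.
have j5 : (\tr (Y^t* *m Y *m L^t* *m L))^* = \tr (Y^t* *m Y *m L^t* *m L).
  by rewrite tJ !adj_mul !trmxCK -!mulmxA mulmxA mxtrace_mulC !mulmxA.
have n5 : Y^t* *m Y *m L *m L^t* = Y^t* *m Y *m L^t* *m L by rewrite -!mulmxA nL.
rewrite n5 addrAC; exact: dissipation_eq j1 j2 j3 j4 j5 d e.
Qed.

(** * Attractors of a normal Lindblad operator *)

Section Lindblad.
Variable R : realType.
Implicit Types H L X Y : op2 R.

(** Pairing Y with its image under the generator gives i w times the squared norm of Y, which is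
    purely imaginary. *)
Lemma eigen_lindbladian_comm H L Y (w : R) : H^t* = H -> L \is normalmx ->
  lindbladian H L Y = ('i * real_complex R w) *: Y -> L *m Y = Y *m L.
Proof.
move=> hH nL eY.
have e : \tr (Y^t* *m lindbladian H L Y) + (\tr (Y^t* *m lindbladian H L Y))^* = 0.
  rewrite eY -scalemxAr mxtraceZ [(_ * _)^*]rmorphM /= -(tr_adj (Y^t* *m Y)).
  rewrite adj_mul trmxCK rmorphM /= conjCi.
  rewrite (CrealP _); last by apply/complex_realP; exists w.
  ring.
have d : \tr (Y^t* *m lindbladian H L Y) =
  - 'i * (\tr (Y^t* *m H *m Y) - \tr (Y^t* *m Y *m H))
  + \tr (Y^t* *m L *m Y *m L^t*)
  - 2^-1 * (\tr (Y^t* *m L^t* *m L *m Y) + \tr (Y^t* *m Y *m L^t* *m L)).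
  rewrite /lindbladian /commutator /anticommutator.
  rewrite !mulmxBr !mulmxDr -!scalemxAr !mulmxBr !mulmxDr !mulmxA.
  have tB (A B : op2 R) : \tr (A - B) = \tr A - \tr B by rewrite raddfB.
  by rewrite !(tB, mxtraceD, mxtraceZ).
exact: comm_of_dissipation_free hH nL d e.
Qed.

Lemma attractor_comm H L X : H^t* = H -> L \is normalmx ->
  attractor H L X -> L *m X = X *m L.
Proof.
move=> hH nL [ws [Y [_ eY ->]]]; rewrite mulmx_sumr mulmx_suml.
by apply: eq_big_seq => w /eY; exact: eigen_lindbladian_comm.
Qed.

(** X also commutes with the adjoint of L, so the dissipator vanishes on X and only the Hamiltonian
    part acts. *)
Lemma comm_attractor H L X (w : R) : L \is normalmx -> L *m X = X *m L ->
  commutator H X = real_complex R w *: X -> attractor H L X.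
Proof.
(* The frequency is - w because the generator contains -i [H, X]. *)
move=> nL cLX eX; exists [:: - w], (fun=> X); split=> //; last by rewrite big_seq1.
move=> _ /[!inE]/eqP ->; rewrite /lindbladian eX /anticommutator.
have cLX' := normal_comm_adj nL cLX.
have -> : L *m X *m L^t* = X *m L^t* *m L by rewrite cLX -!mulmxA (normalmxP nL).
have -> : L^t* *m L *m X = X *m L^t* *m L by rewrite -mulmxA cLX mulmxA cLX'.
rewrite mulmxA -mulr2n -[(_ *m _) *+ 2]scaler_nat !scalerA.
have -> : 2^-1 * 2%:R = 1 :> R[i] by rewrite mulVf ?pnatr_eq0.
by rewrite scale1r addrK rmorphN mulNr mulrN.
Qed.
End Lindblad.

Lemma span4P (K : fieldType) (V : vectType K) (v1 v2 v3 v4 X : V) :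
  reflect (exists x1 x2 x3 x4,
      X = x1 *: v1 + (x2 *: v2 + (x3 *: v3 + x4 *: v4)))
    (X \in <<[:: v1; v2; v3; v4]>>%VS).
Proof.
apply: (iffP idP).
  rewrite !span_cons span_nil addv0.
  move=> /memv_addP[_ /vlineP[x1 ->] [_ /memv_addP[_ /vlineP[x2 ->]
    [_ /memv_addP[_ /vlineP[x3 ->] [_ /vlineP[x4 ->] ->]] ->]] ->]].
  by exists x1, x2, x3, x4.
move=> [x1 [x2 [x3 [x4 ->]]]]; rewrite !memvD ?memvZ //; apply: memv_span;
by rewrite !inE eqxx ?orbT.
Qed.

(** * Phase locking in coordinates on [X_DeltaE] *)

Section Reduced.
Variable R : realType.
Local Notation C := R[i].

Lemma ket_delta (i j : 'I_2) : ket R i j = delta_mx (mxtens_index (i, j)) 0.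
Proof.
apply/matrixP => a b; rewrite !mxE !ord1 !eqxx !andbT -natrM mulnb.
by rewrite -{3}(mxtens_unindexK a) (can_eq (@mxtens_indexK _ _)) xpair_eqE.
Qed.

Lemma ketbra_delta (i j k l : 'I_2) :
  ketbra R i j k l = delta_mx (mxtens_index (i, j)) (mxtens_index (k, l)).
Proof.
rewrite /ketbra !ket_delta trmx_delta map_delta_mx mul_delta_mx //.
Qed.

(* x1 |00><01| + x2 |00><10| + x3 |01><11| + x4 |10><11| *)
Definition coherence (C : numClosedFieldType) (x1 x2 x3 x4 : C) : 'M[C]_(2 * 2) :=
  op4 0 x1 x2 0 0 0 0 x3 0 0 0 x4 0 0 0 0.

Lemma free_hamE (E0 E1 : R) : free_ham E0 E1 =
  op4 (real_complex R (2 * E0)) 0 0 0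
      0 (real_complex R (E0 + E1)) 0 0 0 0 (real_complex R (E0 + E1)) 0
      0 0 0 (real_complex R (2 * E1)).
Proof.
apply/matrixP; apply: ord4P => i hi Hi; apply: ord4P => j hj Hj; rewrite !mxE /=.
move: Hi Hj hi hj => [|[|[|]]] -> [|[|[|]]] -> hi hj /=;
rewrite ?(mulr0, mul0r, mulr1, mul1r, addr0, add0r) //= -?rmorphD ?mulr_natl ?mulr2n //.
by rewrite [E1 + E0]addrC.
Qed.

Lemma X_DeltaEP (X : op2 R) :
  reflect (exists x1 x2 x3 x4, X = coherence x1 x2 x3 x4) (X \in X_DeltaE R).
Proof.
have e x1 x2 x3 x4 : coherence x1 x2 x3 x4 = x1 *: ketbra R 0 0 0 1 +
  (x2 *: ketbra R 0 0 1 0 + (x3 *: ketbra R 0 1 1 1 + x4 *: ketbra R 1 0 1 1)).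
  rewrite !ketbra_delta.
  apply/matrixP; apply: ord4P => i hi Hi; apply: ord4P => j hj Hj; rewrite !mxE /=.
  move: Hi Hj hi hj => [|[|[|]]] -> [|[|[|]]] -> hi hj /=;
  by rewrite ?(mulr0, mulr1, addr0, add0r).
by apply: (iffP (span4P _ _ _ _ _)) => -[x1 [x2 [x3 [x4 ->]]]];
  exists x1, x2, x3, x4; rewrite e.
Qed.

Lemma ptraceA_coherence (x1 x2 x3 x4 : C) :
  ptraceA (coherence x1 x2 x3 x4) = (x1 + x4) *: delta_mx 0 1.
Proof.
apply/matrixP => i j; rewrite !mxE !big_ord_recl big_ord0 !mxE /=.
move: i j => [[|[|//]] hi] [[|[|//]] hj] /=;
  by rewrite ?(mulr0, mulr1, addr0, add0r).
Qed.

Lemma ptraceB_coherence (x1 x2 x3 x4 : C) :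
  ptraceB (coherence x1 x2 x3 x4) = (x2 + x3) *: delta_mx 0 1.
Proof.
apply/matrixP => i j; rewrite !mxE !big_ord_recl big_ord0 !mxE /=.
move: i j => [[|[|//]] hi] [[|[|//]] hj] /=;
  by rewrite ?(mulr0, mulr1, addr0, add0r).
Qed.

(* Phase locking in coordinates on X_DeltaE, with e = e^{i phi}. *)
Definition locks (C : numClosedFieldType) (L : 'M[C]_(2 * 2)) (e : C) : Prop :=
  (forall x1 x2 x3 x4, L *m coherence x1 x2 x3 x4 = coherence x1 x2 x3 x4 *m L ->
     x1 + x4 = e * (x2 + x3)) /\
  (exists x1 x2 x3 x4, L *m coherence x1 x2 x3 x4 = coherence x1 x2 x3 x4 *m L /\
     x2 + x3 != 0).

(** Every coherence is an eigenvector of [H, .] for E0 - E1, so it is an attractor exactly when it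
    commutes with L. Both partial traces are multiples of |0><1|, so locking is a scalar
    equation. *)
Lemma enforces_phase_lockingE (E0 E1 : R) (L : op2 R) (phi : R) :
  L \is normalmx ->
  enforces_phase_locking E0 E1 L phi <-> locks L (expi phi).
Proof.
move=> nL.
have hH : (free_ham E0 E1)^t* = free_ham E0 E1.
  by rewrite free_hamE adj_op4 !conjC0 !conj_Creal //; apply/complex_realP; eexists.
have att x1 x2 x3 x4 : attractor (free_ham E0 E1) L (coherence x1 x2 x3 x4) <->
    L *m coherence x1 x2 x3 x4 = coherence x1 x2 x3 x4 *m L.
  split; first exact: attractor_comm.
  move=> cLX; apply: (comm_attractor (w := E0 - E1)) => //.
  rewrite /commutator free_hamE /coherence !mul_op4 sub_op4 scale_op4.
  congr op4; rewrite ?rmorphD ?rmorphB ?rmorphM /=; ring.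
have d0 : (delta_mx 0 1 : op1 R) != 0.
  by apply/eqP=> /matrixP/(_ 0 1); rewrite !mxE /= => /eqP; rewrite oner_eq0.
split=> -[h [X]].
  move=> [aX /X_DeltaEP[x1 [x2 [x3 [x4 eX]]]] tX]; rewrite {}eX in aX tX.
  split.
    move=> y1 y2 y3 y4 /att aY; have mY : coherence y1 y2 y3 y4 \in X_DeltaE R.
      by apply/X_DeltaEP; do 4 eexists.
    move: (h _ aY mY); rewrite ptraceA_coherence ptraceB_coherence scalerA.
    move/eqP; rewrite -subr_eq0 -scalerBl scaler_eq0 (negPf d0) orbF subr_eq0.
    by move/eqP.
  exists x1, x2, x3, x4; split; first exact/att.
  apply/eqP => e; apply: tX; rewrite ptraceB_coherence e scale0r //.
(* In this direction [X] is the first coordinate of the witness, not an operator. *)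
move=> [x2 [x3 [x4 [c hx]]]]; split.
  move=> Y aY /X_DeltaEP[y1 [y2 [y3 [y4 eY]]]]; rewrite {}eY in aY *.
  by rewrite ptraceA_coherence ptraceB_coherence scalerA (h y1 y2 y3 y4) //; apply/att.
exists (coherence X x2 x3 x4); split; first exact/att.
  by apply/X_DeltaEP; do 4 eexists.
by rewrite ptraceB_coherence => /eqP; rewrite scaler_eq0 (negPf hx) (negPf d0).
Qed.
End Reduced.

(** * Three kinds of commuting operators *)

Section Trichotomy.
Variable C : numClosedFieldType.
Implicit Types (L X : 'M[C]_(2 * 2)) (e : C).

Lemma comm_mxZ L X (a : C) : comm_mx L X -> comm_mx L (a *: X).
Proof. by rewrite /comm_mx -scalemxAr -scalemxAl => ->. Qed.

Lemma scale_coherence (a x1 x2 x3 x4 : C) :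
  a *: coherence x1 x2 x3 x4 = coherence (a * x1) (a * x2) (a * x3) (a * x4).
Proof. by rewrite /coherence scale_op4 !mulr0. Qed.

Lemma lock_trichotomy L e : L \is normalmx -> locks L e ->
  [\/ comm_mx L (coherence e 1 0 0), comm_mx L (coherence 0 0 1 e)
   | (forall x1 x2, comm_mx L (coherence x1 x2 0 0) -> x2 = 0) /\
     (exists x1 x2 x3 x4, [/\ comm_mx L (coherence x1 x2 x3 x4),
        x1 * x3 + x2 * x4 = 0,
        x1 * x1^* + x2 * x2^* = x3 * x3^* + x4 * x4^*,
        x1 + x4 = e * (x2 + x3) & x2 + x3 != 0])].
Proof.
move=> nL [hf [x1 [x2 [x3 [x4 [cX g0]]]]]].
have [cA|nA] := eqVneq (L *m coherence e 1 0 0) (coherence e 1 0 0 *m L).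
  by constructor 1.
have [cB|nB] := eqVneq (L *m coherence 0 0 1 e) (coherence 0 0 1 e *m L).
  by constructor 2.
(* Locking gives y1 = e y2; a nonzero y2 could be scaled to 1, which yields the excluded
   [coherence e 1 0 0]. *)
have hA y1 y2 : comm_mx L (coherence y1 y2 0 0) -> y2 = 0.
  move=> cY; apply/eqP; apply: contraNT nA => y20.
  have := hf _ _ _ _ cY; rewrite !addr0 => ey; rewrite ey in cY.
  have := comm_mxZ y2^-1 cY; rewrite scale_coherence !mulr0 mulrCA mulVf // mulr1.
  by move/eqP.
have hB y3 y4 : comm_mx L (coherence 0 0 y3 y4) -> y3 = 0.
  move=> cY; apply/eqP; apply: contraNT nB => y30.
  have := hf _ _ _ _ cY; rewrite !add0r => ey; rewrite ey in cY.
  have := comm_mxZ y3^-1 cY; rewrite scale_coherence !mulr0 mulrCA mulVf // mulr1.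
  by move/eqP.
constructor 3; split=> //; exists x1, x2, x3, x4.
have cXa : comm_mx L ((coherence x1 x2 x3 x4)^t*).
  have := congr1 (fun A : 'M[C]_(2 * 2) => A^t* ) (normal_comm_adj nL cX).
  by rewrite !adj_mul trmxCK => /esym.
(* With X = |00><v| + |w><11|, these are the squared norms of v and w, and [ip] is <v|w>. *)
set nv := x1 * x1^* + x2 * x2^*; set nw := x3 * x3^* + x4 * x4^*.
set ip := x1 * x3 + x2 * x4.
have cX3 : comm_mx L (coherence (nv * x1) (nv * x2) (nw * x3) (nw * x4)).
  have <- : coherence x1 x2 x3 x4 *m (coherence x1 x2 x3 x4)^t* *m coherence x1 x2 x3 x4
     = coherence (nv * x1) (nv * x2) (nw * x3) (nw * x4).
    rewrite /coherence adj_op4 !mul_op4 /nv /nw !conjC0; congr op4; ring.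
  by do 2!apply: comm_mxM => //.
have cY : comm_mx L (coherence 0 0 (ip * x1^*) (ip * x2^*)).
  have <- : (coherence x1 x2 x3 x4)^t* *m coherence x1 x2 x3 x4 *m coherence x1 x2 x3 x4
     = coherence 0 0 (ip * x1^*) (ip * x2^*).
    rewrite /coherence adj_op4 !mul_op4 /ip !conjC0; congr op4; ring.
  by do 2!apply: comm_mxM => //.
(* If the norms differed, combining X X^* X with multiples of X would isolate each half of X, and
   [hA], [hB] would give x2 = x3 = 0. *)
have nvw : nv = nw.
  apply/eqP; apply: contraNT g0; rewrite -subr_eq0 => d0.
  have cv : comm_mx L (coherence ((nv - nw) * x1) ((nv - nw) * x2) 0 0).
    have := comm_mxB cX3 (comm_mxZ nw cX).
    rewrite /coherence scale_op4 sub_op4; congr (comm_mx _ _); congr op4; ring.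
  have cw : comm_mx L (coherence 0 0 ((nv - nw) * x3) ((nv - nw) * x4)).
    have := comm_mxB (comm_mxZ nv cX) cX3.
    rewrite /coherence scale_op4 sub_op4; congr (comm_mx _ _); congr op4; ring.
  have /eqP := hA _ _ cv; rewrite mulf_eq0 (negPf d0) => /eqP ->.
  have /eqP := hB _ _ cw; rewrite mulf_eq0 (negPf d0) => /eqP ->.
  by rewrite addr0.
(* X^* X X = <v|w> |v><11| has only the second half. If <v|w> is nonzero, [hB] kills x1, the lock
   equation kills x2, and equality of norms then kills w. *)
have ip0 : ip = 0.
  apply/eqP; apply: contraNT g0 => d0.
  have := hf _ _ _ _ cY; rewrite !add0r (hB _ _ cY) mulr0.
  have /eqP := hB _ _ cY; rewrite mulf_eq0 (negPf d0) conjC_eq0 => /eqP x10.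
  move=> /eqP; rewrite mulf_eq0 (negPf d0) conjC_eq0 => /eqP x20.
  move: nvw; rewrite /nv /nw x10 x20 !mul0r add0r => /esym/eqP.
  rewrite -!normCK paddr_eq0 ?exprn_ge0 // !sqrf_eq0 !normr_eq0 => /andP[/eqP-> _].
  by rewrite addr0.
by split=> //; apply: hf.
Qed.
End Trichotomy.

(** * Unitary changes of basis fixing |00> and |11> *)

Section Frames.
Variable C : numClosedFieldType.
Implicit Types (T L M K : 'M[C]_(2 * 2)) (e p q r s : C).

Lemma comm_mx_unitary_conj T M K : T^t* *m T = 1%:M ->
  comm_mx (T *m M *m T^t*) (T *m K *m T^t*) <-> comm_mx M K.
Proof.
move=> uT.
have e A B : T *m A *m T^t* *m (T *m B *m T^t*) = T *m (A *m B) *m T^t*.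
  by rewrite !mulmxA -(mulmxA _ (T^t*) T) uT mulmx1.
have i A : T^t* *m (T *m A *m T^t*) *m T = A.
  by rewrite !mulmxA uT mul1mx -mulmxA uT mulmx1.
rewrite /comm_mx !e; split=> [h|-> //].
by rewrite -(i (M *m K)) h i.
Qed.

Lemma unitary_conjK T L : T^t* *m T = 1%:M -> T *m (T^t* *m L *m T) *m T^t* = L.
Proof.
by move=> /mulmx1C uT; rewrite !mulmxA uT mul1mx -mulmxA uT mulmx1.
Qed.

Lemma normal_unitary_conj T L : T^t* *m T = 1%:M -> L \is normalmx ->
  T^t* *m L *m T \is normalmx.
Proof.
move=> /mulmx1C uT /normalmxP nL; apply/normalmxP.
have e A B : T^t* *m A *m T *m (T^t* *m B *m T) = T^t* *m (A *m B) *m T.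
  by rewrite !mulmxA -(mulmxA _ T) uT mulmx1.
have -> : (T^t* *m L *m T)^t* = T^t* *m L^t* *m T.
  by rewrite !adj_mul trmxCK mulmxA.
by rewrite !e nL.
Qed.

Definition frame p q r s : 'M[C]_(2 * 2) :=
  op4 1 0 0 0 0 p q 0 0 r s 0 0 0 0 1.

Definition unitary22 p q r s : Prop :=
  [/\ p^* * p + r^* * r = 1, q^* * q + s^* * s = 1 & p^* * q + r^* * s = 0].

Lemma frame_unitary p q r s : unitary22 p q r s ->
  (frame p q r s)^t* *m frame p q r s = 1%:M.
Proof.
case=> h1 h2 h3; rewrite /frame adj_op4 mul_op4 op4_1 !conjC0 !conjC1.
have h4 : q^* * p + s^* * r = 0.
  by rewrite -(conjC0 C) -h3 rmorphD !rmorphM /= !conjCK mulrC [s^* * r]mulrC.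
rewrite !(mul0r, mulr0, mul1r, addr0, add0r); congr op4 => //.
Qed.

Lemma frame_coherence p q r s y1 y2 y3 y4 :
  frame p q r s *m coherence y1 y2 y3 y4 *m (frame p q r s)^t* =
  coherence (y1 * p^* + y2 * q^*) (y1 * r^* + y2 * s^*)
            (p * y3 + q * y4) (r * y3 + s * y4).
Proof.
rewrite /frame /coherence adj_op4 !mul_op4 !conjC0 !conjC1.
by rewrite !(mul0r, mulr0, mul1r, mulr1, addr0, add0r).
Qed.

Lemma coherence_frameP p q r s x1 x2 x3 x4 : unitary22 p q r s ->
  exists y1 y2 y3 y4, coherence x1 x2 x3 x4 =
    frame p q r s *m coherence y1 y2 y3 y4 *m (frame p q r s)^t*.
Proof.
move=> /frame_unitary uT; set T := frame p q r s.
have e : T^t* *m coherence x1 x2 x3 x4 *m T =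
    coherence (x1 * p + x2 * r) (x1 * q + x2 * s) (p^* * x3 + r^* * x4)
              (q^* * x3 + s^* * x4).
  rewrite /T /frame /coherence adj_op4 !mul_op4 !conjC0 !conjC1.
  by rewrite !(mul0r, mulr0, mul1r, mulr1, addr0, add0r).
exists (x1 * p + x2 * r), (x1 * q + x2 * s), (p^* * x3 + r^* * x4),
  (q^* * x3 + s^* * x4).
by rewrite -e unitary_conjK.
Qed.

(** Conjugation by the frame permutes the coherences, so both lock conditions pull back to M through
    the coordinates of [frame_coherence]. *)
Lemma locks_frame p q r s M e : unitary22 p q r s ->
  locks (frame p q r s *m M *m (frame p q r s)^t*) e <->
  (forall y1 y2 y3 y4, comm_mx M (coherence y1 y2 y3 y4) ->
     y1 * p^* + y2 * q^* + (r * y3 + s * y4) =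
     e * (y1 * r^* + y2 * s^* + (p * y3 + q * y4))) /\
  (exists y1 y2 y3 y4, comm_mx M (coherence y1 y2 y3 y4) /\
     y1 * r^* + y2 * s^* + (p * y3 + q * y4) != 0).
Proof.
move=> u; have uT := frame_unitary u; set T := frame p q r s in uT *.
split=> -[h1 [x1 [x2 [x3 [x4 [h2 h3]]]]]]; split.
- move=> y1 y2 y3 y4 cy; apply: h1; rewrite -frame_coherence.
  exact/comm_mx_unitary_conj.
- have [y1 [y2 [y3 [y4 ey]]]] := coherence_frameP x1 x2 x3 x4 u.
  exists y1, y2, y3, y4; split.
    by apply/(comm_mx_unitary_conj _ _ uT); rewrite -ey.
  move: ey; rewrite frame_coherence => /op4_inj ey.
  by rewrite -!ey.
- move=> y1 y2 y3 y4 cy.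
  have [z1 [z2 [z3 [z4 ez]]]] := coherence_frameP y1 y2 y3 y4 u.
  rewrite ez in cy; move/(comm_mx_unitary_conj _ _ uT): cy => /h1.
  move: ez; rewrite frame_coherence => /op4_inj ez.
  by rewrite -!ez.
- exists (x1 * p^* + x2 * q^*), (x1 * r^* + x2 * s^*),
    (p * x3 + q * x4), (r * x3 + s * x4); split=> //.
  by rewrite -frame_coherence; apply/comm_mx_unitary_conj.
Qed.

(* The matrices of forms (1), (2) and (3), with t = e^{2 i theta} in [core3]. *)
Definition core1 (c a b b' d : C) := op4 c 0 0 0 0 c 0 0 0 0 a b 0 0 b' d.
Definition core2 (c a b b' d : C) := op4 a b 0 0 b' d 0 0 0 0 c 0 0 0 0 c.
Definition core3 (t a b b' d : C) := op4 a b 0 0 b' d 0 0 0 0 a (t^* * b) 0 0 (t * b') d.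

Lemma comm_core1 c a b b' d y1 y2 y3 y4 :
  comm_mx (core1 c a b b' d) (coherence y1 y2 y3 y4) <->
  [/\ c * y2 = y2 * a, y2 * b = 0, y3 * b' = 0, c * y3 = y3 * d
    & y4 * b' = 0 /\ a * y4 = y4 * d].
Proof.
rewrite /comm_mx /core1 /coherence !mul_op4.
rewrite !(mul0r, mulr0, mul1r, mulr1, addr0, add0r).
split=> [/op4_inj[[[[[[h00 h01] h02] h03] [[[h10 h11] h12] h13]] [[[h20 h21] h22] h23]] [[[h30 h31] h32] h33]]|[h1 h2 h3 h4 [h5 h6]]].
  by do !split.
by rewrite h1 h2 h3 h4 h5 h6 [c * y1]mulrC [b' * y4]mulrC h5.
Qed.

Lemma comm_core2 c a b b' d y1 y2 y3 y4 :
  comm_mx (core2 c a b b' d) (coherence y1 y2 y3 y4) <->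
  [/\ y1 * b' = 0, a * y1 = y1 * d, a * y2 = y2 * c, b * y3 = 0
    & b' * y2 = 0 /\ d * y3 = y3 * c].
Proof.
rewrite /comm_mx /core2 /coherence !mul_op4.
rewrite !(mul0r, mulr0, mul1r, mulr1, addr0, add0r).
split=> [/op4_inj[[[[[[h00 h01] h02] h03] [[[h10 h11] h12] h13]] [[[h20 h21] h22] h23]] [[[h30 h31] h32] h33]]|[h1 h2 h3 h4 [h5 h6]]].
  by do !split.
by rewrite h1 h2 h3 h4 h5 h6 [c * y4]mulrC [b' * y1]mulrC h1.
Qed.

Lemma comm_core3 t a b b' d y1 y2 y3 y4 :
  comm_mx (core3 t a b b' d) (coherence y1 y2 y3 y4) ->
  [/\ y1 * b' = 0, y4 * (t * b') = 0, b * y3 = y2 * (t^* * b) & b' * y2 = y3 * (t * b')].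
Proof.
rewrite /comm_mx /core3 /coherence !mul_op4.
rewrite !(mul0r, mulr0, mul1r, mulr1, addr0, add0r).
by move=> /op4_inj[[[[[[h00 h01] h02] h03] [[[h10 h11] h12] h13]] [[[h20 h21] h22] h23]] [[[h30 h31] h32] h33]].
Qed.
End Frames.

(** * Normal operators commuting with a given coherence *)

Section Cores.
Variable C : numClosedFieldType.
Implicit Types (L M : 'M[C]_(2 * 2)) (a b d e p t y : C).

Lemma eq0_conjC (x : C) : 0 = x^* -> x = 0.
Proof. by move=> /esym/eqP; rewrite conjC_eq0 => /eqP. Qed.

(* Normality of the matrix [a, b; b', d]. *)
Definition normal_block a b b' d : Prop :=
  b * b^* = b' * b'^* /\ (a - d) * b'^* = (a - d)^* * b.

Lemma normal_block0 a b b' d : normal_block a b b' d -> (b == 0) = (b' == 0).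
Proof.
move=> [h _]; have : (b * b^* == 0) = (b' * b'^* == 0) by rewrite h.
by rewrite !mulf_eq0 !conjC_eq0 !orbb.
Qed.

Lemma normal_op4_block a b b' d a2 b2 b2' d2 :
  op4 a b 0 0 b' d 0 0 0 0 a2 b2 0 0 b2' d2 \is normalmx ->
  normal_block a b b' d /\ normal_block a2 b2 b2' d2.
Proof.
(* The hypotheses are the first two entries of N N^* = N^* N for the block N = [x, y; z, w]. *)
have blk x y z w : x * x^* + y * y^* = x^* * x + z^* * z ->
    x * z^* + y * w^* = x^* * y + z^* * w -> normal_block x y z w.
  move=> h1 h2; split.
    by apply: (addrI (x * x^* )); rewrite h1 mulrC [z * _]mulrC.
  apply/eqP; rewrite -subr_eq0 rmorphB /=.
  have -> : (x - w) * z^* - (x^* - w^* ) * y =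
    x * z^* + y * w^* - (x^* * y + z^* * w) by ring.
  by rewrite h2 subrr.
move/normalmxP; rewrite adj_op4 !mul_op4 !conjC0.
rewrite !(mul0r, mulr0, addr0, add0r).
by move=> /op4_inj[[[[[[h00 h01] h02] h03] [[[h10 h11] h12] h13]] [[[h20 h21] h22] h23]] [[[h30 h31] h32] h33]]; split; apply: blk.
Qed.

(** M commutes with |00><01| and, being normal, with its adjoint. So M is a scalar on span {|00>,
    |01>} and leaves span {|10>, |11>} invariant. *)
Lemma core1_of_comm M : M \is normalmx -> comm_mx M (coherence 1 0 0 0) ->
  exists c a b b' d, M = core1 c a b b' d /\ normal_block a b b' d.
Proof.
move=> nM cM; have cM' := normal_comm_adj nM cM; move: nM.
have [m00 [m01 [m02 [m03 [m10 [m11 [m12 [m13 [m20 [m21 [m22 [m23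
  [m30 [m31 [m32 [m33 eM]]]]]]]]]]]]]]]] := op4E M.
move: cM cM'; rewrite eM /comm_mx /coherence adj_op4 !mul_op4.
rewrite !(mul0r, mulr0, mul1r, mulr1, addr0, add0r).
move=> /op4_inj[[[[[[h00 h01] h02] h03] [[[h10 h11] h12] h13]] [[[h20 h21] h22] h23]] [[[h30 h31] h32] h33]].
move=> /op4_inj[[[[[[k00 k01] k02] k03] [[[k10 k11] k12] k13]] [[[k20 k21] k22] k23]] [[[k30 k31] k32] k33]].
move: k00 k02 k03 k21 k31 => /eq0_conjC-> /eq0_conjC-> /eq0_conjC->.
move=> /esym/eq0_conjC-> /esym/eq0_conjC->.
rewrite -h00 -h01 -h02 -h03 h21 h31 => /normal_op4_block[_ nb].
by exists m00, m22, m23, m32, m33.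
Qed.

Lemma core2_of_comm M : M \is normalmx -> comm_mx M (coherence 0 0 0 1) ->
  exists c a b b' d, M = core2 c a b b' d /\ normal_block a b b' d.
Proof.
move=> nM cM; have cM' := normal_comm_adj nM cM; move: nM.
have [m00 [m01 [m02 [m03 [m10 [m11 [m12 [m13 [m20 [m21 [m22 [m23
  [m30 [m31 [m32 [m33 eM]]]]]]]]]]]]]]]] := op4E M.
move: cM cM'; rewrite eM /comm_mx /coherence adj_op4 !mul_op4.
rewrite !(mul0r, mulr0, mul1r, mulr1, addr0, add0r).
move=> /op4_inj[[[[[[h00 h01] h02] h03] [[[h10 h11] h12] h13]] [[[h20 h21] h22] h23]] [[[h30 h31] h32] h33]].
move=> /op4_inj[[[[[[k00 k01] k02] k03] [[[k10 k11] k12] k13]] [[[k20 k21] k22] k23]] [[[k30 k31] k32] k33]].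
move: k20 k21 k22 k03 k13 => /eq0_conjC-> /eq0_conjC-> /eq0_conjC->.
move=> /esym/eq0_conjC-> /esym/eq0_conjC->.
rewrite h03 h13 -h20 -h21 h33 -h23 => /normal_op4_block[nb _].
by exists m22, m00, m01, m10, m11.
Qed.


(** The coherence is a partial isometry sending |10> to t |00> and |11> to |01>. Since M commutes
    with it and with its adjoint, both planes are invariant and M acts on them alike, up to the
    phase t. *)
Lemma core3_of_comm M t : t != 0 -> t^* * t = 1 -> M \is normalmx ->
  comm_mx M (coherence 0 t 1 0) ->
  exists a b b' d, M = core3 t a b b' d /\ normal_block a b b' d.
Proof.
move=> t0 tt.
move=> nM cM; have cM' := normal_comm_adj nM cM; move: nM.
have [m00 [m01 [m02 [m03 [m10 [m11 [m12 [m13 [m20 [m21 [m22 [m23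
  [m30 [m31 [m32 [m33 eM]]]]]]]]]]]]]]]] := op4E M.
move: cM cM'; rewrite eM /comm_mx /coherence adj_op4 !mul_op4.
rewrite !(mul0r, mulr0, mul1r, mulr1, addr0, add0r).
move=> /op4_inj[[[[[[h00 h01] h02] h03] [[[h10 h11] h12] h13]] [[[h20 h21] h22] h23]] [[[h30 h31] h32] h33]].
move=> /op4_inj[[[[[[k00 k01] k02] k03] [[[k10 k11] k12] k13]] [[[k20 k21] k22] k23]] [[[k30 k31] k32] k33]].
have e20 : m20 = 0 by apply: (mulfI t0); rewrite -h00 mulr0.
have e02 : m02 = 0 by apply/eq0_conjC/(mulfI t0); rewrite -k00 mulr0.
have e22 : m22 = m00 by apply: (mulfI t0); rewrite -h02 mulrC.
have e23 : m23 = t^* * m01 by rewrite h03 mulrA tt mul1r.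
move: k10 k11 k23 => /eq0_conjC-> /eq0_conjC-> /esym/eq0_conjC->.
rewrite e20 e02 e22 e23 h23 -h10 -h11 -h12 -h13 => /normal_op4_block[nb _].
by exists m00, m01, m10, m11; rewrite /core3 [t * m10]mulrC.
Qed.

(** * Locking in the frames of forms (1) and (2), where [sg] stands for 1 / sqrt 2 *)

Section HalfAngle.
Variables (e sg : C).
Hypotheses (sgR : sg^* = sg) (sg2 : 2 * (sg * sg) = 1) (e1 : e^* * e = 1).

Let sg0 : sg != 0.
Proof.
by apply/eqP => h; move: sg2; rewrite h !mulr0 => /esym/eqP; rewrite oner_eq0.
Qed.

Let adjE : (e * sg)^* = e^* * sg. Proof. by rewrite rmorphM /= sgR. Qed.
Let adjN : (- (e * sg))^* = - (e^* * sg). Proof. by rewrite rmorphN /= adjE. Qed.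

Lemma unitary22_T1 : unitary22 sg sg (e * sg) (- (e * sg)).
Proof.
split; rewrite ?adjN ?adjE ?sgR.
- have -> : sg * sg + e^* * sg * (e * sg) = sg * sg * (1 + e^* * e) by ring.
  by rewrite e1 mulrC.
- have -> : sg * sg + - (e^* * sg) * - (e * sg) = sg * sg * (1 + e^* * e) by ring.
  by rewrite e1 mulrC.
have -> : sg * sg + (e^* * sg) * - (e * sg) = sg * sg * (1 - e^* * e) by ring.
by rewrite e1 subrr mulr0.
Qed.

Lemma unitary22_T2 : unitary22 sg sg (- (e * sg)) (e * sg).
Proof.
split; rewrite ?adjN ?adjE ?sgR.
- have -> : sg * sg + - (e^* * sg) * - (e * sg) = sg * sg * (1 + e^* * e) by ring.
  by rewrite e1 mulrC.
- have -> : sg * sg + e^* * sg * (e * sg) = sg * sg * (1 + e^* * e) by ring.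
  by rewrite e1 mulrC.
have -> : sg * sg + - (e^* * sg) * (e * sg) = sg * sg * (1 - e^* * e) by ring.
by rewrite e1 subrr mulr0.
Qed.

Local Notation F1 := (frame sg sg (e * sg) (- (e * sg))).
Local Notation F2 := (frame sg sg (- (e * sg)) (e * sg)).

Lemma eq_iff_sub_mul (x y k z : C) : k != 0 -> x - y = k * z -> (x = y) <-> z = 0.
Proof.
move=> k0 h; split=> [e0|z0].
  by apply/eqP; move/eqP: h; rewrite e0 subrr eq_sym mulf_eq0 (negPf k0).
by apply/eqP; rewrite -subr_eq0 h z0 mulr0.
Qed.

Let k0 : 2 * sg != 0. Proof. by rewrite mulf_neq0 ?pnatr_eq0. Qed.

(** The two sides of the lock equation differ by [2 * sg * (y2 - e * y4)]; the coordinates y1 and y3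
    drop out. *)
Lemma locks_F1 M : locks (F1 *m M *m F1^t*) e <->
  (forall y1 y2 y3 y4, comm_mx M (coherence y1 y2 y3 y4) -> y2 - e * y4 = 0) /\
  (exists y1 y2 y3 y4, comm_mx M (coherence y1 y2 y3 y4) /\
     e^* * (y1 - y2) + y3 + y4 != 0).
Proof.
rewrite (locks_frame _ _ unitary22_T1) adjN adjE !sgR.
have f y1 y2 y3 y4 : y1 * sg + y2 * sg + (e * sg * y3 + - (e * sg) * y4) =
    e * (y1 * (e^* * sg) + y2 * - (e^* * sg) + (sg * y3 + sg * y4)) <->
    y2 - e * y4 = 0.
  apply: (eq_iff_sub_mul k0).
  have -> : y1 * sg + y2 * sg + (e * sg * y3 + - (e * sg) * y4) -
    e * (y1 * (e^* * sg) + y2 * - (e^* * sg) + (sg * y3 + sg * y4)) =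
    sg * (y1 + y2 - 2 * e * y4 - (e^* * e) * (y1 - y2)) by ring.
  by rewrite e1; ring.
have g y1 y2 y3 y4 : y1 * (e^* * sg) + y2 * - (e^* * sg) + (sg * y3 + sg * y4) =
    sg * (e^* * (y1 - y2) + y3 + y4) by ring.
split=> -[h1 [y1 [y2 [y3 [y4 [cy h2]]]]]]; split.
- move=> z1 z2 z3 z4 cz; exact: (f z1 z2 z3 z4).1 (h1 _ _ _ _ cz).
- by exists y1, y2, y3, y4; split=> //; move: h2; rewrite g mulf_eq0 (negPf sg0).
- move=> z1 z2 z3 z4 cz; exact: (f z1 z2 z3 z4).2 (h1 _ _ _ _ cz).
- by exists y1, y2, y3, y4; split=> //; rewrite g mulf_eq0 (negPf sg0).
Qed.

Lemma locks_F2 M : locks (F2 *m M *m F2^t*) e <->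
  (forall y1 y2 y3 y4, comm_mx M (coherence y1 y2 y3 y4) -> y1 - e * y3 = 0) /\
  (exists y1 y2 y3 y4, comm_mx M (coherence y1 y2 y3 y4) /\
     e^* * (y2 - y1) + y3 + y4 != 0).
Proof.
rewrite (locks_frame _ _ unitary22_T2) adjN adjE !sgR.
have f y1 y2 y3 y4 : y1 * sg + y2 * sg + (- (e * sg) * y3 + (e * sg) * y4) =
    e * (y1 * - (e^* * sg) + y2 * (e^* * sg) + (sg * y3 + sg * y4)) <->
    y1 - e * y3 = 0.
  apply: (eq_iff_sub_mul k0).
  have -> : y1 * sg + y2 * sg + (- (e * sg) * y3 + (e * sg) * y4) -
    e * (y1 * - (e^* * sg) + y2 * (e^* * sg) + (sg * y3 + sg * y4)) =
    sg * (y1 + y2 - 2 * e * y3 - (e^* * e) * (y2 - y1)) by ring.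
  by rewrite e1; ring.
have g y1 y2 y3 y4 : y1 * - (e^* * sg) + y2 * (e^* * sg) + (sg * y3 + sg * y4) =
    sg * (e^* * (y2 - y1) + y3 + y4) by ring.
split=> -[h1 [y1 [y2 [y3 [y4 [cy h2]]]]]]; split.
- move=> z1 z2 z3 z4 cz; exact: (f z1 z2 z3 z4).1 (h1 _ _ _ _ cz).
- by exists y1, y2, y3, y4; split=> //; move: h2; rewrite g mulf_eq0 (negPf sg0).
- move=> z1 z2 z3 z4 cz; exact: (f z1 z2 z3 z4).2 (h1 _ _ _ _ cz).
- by exists y1, y2, y3, y4; split=> //; rewrite g mulf_eq0 (negPf sg0).
Qed.

Let e0 : e != 0.
Proof.
by apply/eqP => h; move: e1; rewrite h mulr0 => /esym/eqP; rewrite oner_eq0.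
Qed.

(** Locking holds once commutation forces y2 = y4 = 0. If b = 0, then a = c frees y2 and d = a frees
    y4, and either breaks it. The coherence [1 0 0 0] always commutes and makes the locking
    nontrivial. *)
Lemma locks_core1 c a b b' d : (b == 0) = (b' == 0) ->
  locks (F1 *m core1 c a b b' d *m F1^t*) e <-> b != 0 \/ a != c /\ d != a.
Proof.
move=> bb'; rewrite locks_F1; split=> [[h _]|h].
  have [b0|] := eqVneq b 0; last by left.
  have /eqP b'0 : b' == 0 by rewrite -bb' b0.
  right; split; apply/eqP => E.
    have /h/eqP : comm_mx (core1 c a b b' d) (coherence 0 1 0 0).
      by apply/comm_core1; rewrite b0 b'0 E !(mulr0, mul0r, mulr1, mul1r).
    by rewrite mulr0 subr0 oner_eq0.
  have /h/eqP : comm_mx (core1 c a b b' d) (coherence 0 0 0 1).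
    by apply/comm_core1; rewrite b0 b'0 E !(mulr0, mul0r, mulr1, mul1r).
  by rewrite mulr1 sub0r oppr_eq0 (negPf e0).
split.
  move=> y1 y2 y3 y4 /comm_core1[h1 h2 h3 h4 [h5 h6]].
  suff [-> ->] : y2 = 0 /\ y4 = 0 by rewrite mulr0 subr0.
  case: h => [b0|[ac da]].
    move/eqP: h2; rewrite mulf_eq0 (negPf b0) orbF => /eqP.
    by move/eqP: h5; rewrite mulf_eq0 -bb' (negPf b0) orbF => /eqP.
  split; apply/eqP.
    move/eqP: h1; rewrite mulrC -subr_eq0 -mulrBr mulf_eq0 => /orP[//|].
    by rewrite subr_eq0 eq_sym (negPf ac).
  move/eqP: h6; rewrite mulrC -subr_eq0 -mulrBr mulf_eq0 => /orP[//|].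
  by rewrite subr_eq0 eq_sym (negPf da).
exists 1, 0, 0, 0; split.
  by apply/comm_core1; rewrite !(mulr0, mul0r).
by rewrite subr0 mulr1 !addr0 conjC_eq0.
Qed.

(** As for form (1), but now y1 and y3 must vanish: if b = 0, then d = c frees y3 and d = a frees
    y1. The nontrivial witness is [0 0 0 1]. *)
Lemma locks_core2 c a b b' d : (b == 0) = (b' == 0) ->
  locks (F2 *m core2 c a b b' d *m F2^t*) e <-> b != 0 \/ d != c /\ d != a.
Proof.
move=> bb'; rewrite locks_F2; split=> [[h _]|h].
  have [b0|] := eqVneq b 0; last by left.
  have /eqP b'0 : b' == 0 by rewrite -bb' b0.
  right; split; apply/eqP => E.
    have /h/eqP : comm_mx (core2 c a b b' d) (coherence 0 0 1 0).
      by apply/comm_core2; rewrite b0 b'0 E !(mulr0, mul0r, mulr1, mul1r).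
    by rewrite mulr1 sub0r oppr_eq0 (negPf e0).
  have /h/eqP : comm_mx (core2 c a b b' d) (coherence 1 0 0 0).
    by apply/comm_core2; rewrite b0 b'0 E !(mulr0, mul0r, mulr1, mul1r).
  by rewrite mulr0 subr0 oner_eq0.
split.
  move=> y1 y2 y3 y4 /comm_core2[h1 h2 h3 h4 [h5 h6]].
  suff [-> ->] : y1 = 0 /\ y3 = 0 by rewrite mulr0 subr0.
  case: h => [b0|[ac da]].
    move/eqP: h4; rewrite mulf_eq0 (negPf b0) => /eqP.
    by move/eqP: h1; rewrite mulf_eq0 -bb' (negPf b0) orbF => /eqP.
  split; apply/eqP.
    move/eqP: h2; rewrite mulrC -subr_eq0 -mulrBr mulf_eq0 => /orP[//|].
    by rewrite subr_eq0 eq_sym (negPf da).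
  move/eqP: h6; rewrite mulrC -subr_eq0 -mulrBr mulf_eq0 => /orP[//|].
  by rewrite subr_eq0 (negPf ac).
exists 0, 0, 0, 1; split.
  by apply/comm_core2; rewrite !(mulr0, mul0r).
by rewrite subr0 mulr0 !add0r oner_eq0.
Qed.

Lemma core1_of_locks L : L \is normalmx -> locks L e ->
  comm_mx L (coherence e 1 0 0) ->
  exists c a b b' d, [/\ L = F1 *m core1 c a b b' d *m F1^t*,
    normal_block a b b' d & b != 0 \/ a != c /\ d != a].
Proof.
move=> nL lL cL; have uT := frame_unitary unitary22_T1.
(* The first middle column of the frame is chosen so that this coherence becomes a multiple of
   |00><01|. *)
have eX : coherence e 1 0 0 =
    F1 *m ((e * (2 * sg)) *: coherence 1 0 0 0) *m F1^t*.
  rewrite scale_coherence frame_coherence adjN adjE !sgR.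
  congr coherence; [| |ring|ring].
    by transitivity (e * (2 * (sg * sg))); [rewrite sg2 mulr1|ring].
  by transitivity (e^* * e * (2 * (sg * sg))); [rewrite sg2 mulr1|ring].
have cM : comm_mx (F1^t* *m L *m F1) (coherence 1 0 0 0).
  move: cL; rewrite eX -{1}(unitary_conjK L uT) => /(comm_mx_unitary_conj _ _ uT).
  move=> /(comm_mxZ (e * (2 * sg))^-1); rewrite scalerA mulVf ?scale1r //.
  exact: mulf_neq0.
have [c [a [b [b' [d [eM nb]]]]]] := core1_of_comm (normal_unitary_conj uT nL) cM.
have eL : L = F1 *m core1 c a b b' d *m F1^t* by rewrite -eM unitary_conjK.
exists c, a, b, b', d; split=> //.
by apply/(locks_core1 _ _ _ (normal_block0 nb)); rewrite -eL.
Qed.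

Lemma core2_of_locks L : L \is normalmx -> locks L e ->
  comm_mx L (coherence 0 0 1 e) ->
  exists c a b b' d, [/\ L = F2 *m core2 c a b b' d *m F2^t*,
    normal_block a b b' d & b != 0 \/ d != c /\ d != a].
Proof.
move=> nL lL cL; have uT := frame_unitary unitary22_T2.
have eX : coherence 0 0 1 e = F2 *m ((2 * sg) *: coherence 0 0 0 1) *m F2^t*.
  rewrite scale_coherence frame_coherence adjN adjE !sgR.
  congr coherence; [ring|ring| |].
    by transitivity (2 * (sg * sg)); [rewrite sg2|ring].
  by transitivity (e * (2 * (sg * sg))); [rewrite sg2 mulr1|ring].
have cM : comm_mx (F2^t* *m L *m F2) (coherence 0 0 0 1).
  move: cL; rewrite eX -{1}(unitary_conjK L uT) => /(comm_mx_unitary_conj _ _ uT).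
  by move=> /(comm_mxZ (2 * sg)^-1); rewrite scalerA mulVf ?scale1r.
have [c [a [b [b' [d [eM nb]]]]]] := core2_of_comm (normal_unitary_conj uT nL) cM.
have eL : L = F2 *m core2 c a b b' d *m F2^t* by rewrite -eM unitary_conjK.
exists c, a, b, b', d; split=> //.
by apply/(locks_core2 _ _ _ (normal_block0 nb)); rewrite -eL.
Qed.
End HalfAngle.
End Cores.

(** * The frame of form (3); [w], [ct], [t] stand for i e^{-i phi} sin theta, cos theta, e^{2 i
    theta} *)

Section Core3.
Variable C : numClosedFieldType.
Variables w ct t : C.
Hypotheses (ctR : ct^* = ct) (wct : w^* * w + ct * ct = 1) (tt : t^* * t = 1).

Local Notation F3 := (frame w ct (- ct) w^*).

Let ctN : (- ct)^* = - ct. Proof. by rewrite rmorphN /= ctR. Qed.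

Lemma unitary22_Ttheta : unitary22 w ct (- ct) w^*.
Proof.
split; rewrite ?ctN ?ctR ?conjCK.
- by rewrite mulrNN.
- by rewrite addrC mulrC wct.
- by rewrite mulNr mulrC subrr.
Qed.

Let t0 : t != 0.
Proof.
by apply/eqP => h; move: tt; rewrite h mulr0 => /esym/eqP; rewrite oner_eq0.
Qed.

(** With b and b' nonzero, only multiples of [coherence 0 t 1 0] can commute with the core; for this
    coherence the last two hypotheses are the lock equation and its nontriviality. *)
Lemma locks_core3 e a b b' d : b != 0 -> b' != 0 ->
  ct * (t - 1) = e * w * (t + 1) -> w * (t + 1) != 0 ->
  locks (F3 *m core3 t a b b' d *m F3^t*) e.
Proof.
move=> b0 b'0 hp g0; apply/(locks_frame _ _ unitary22_Ttheta).
rewrite ctN ctR conjCK; split.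
  move=> y1 y2 y3 y4 /comm_core3[/eqP h1 /eqP h2 h3 h4].
  move: h1 h2; rewrite !mulf_eq0 (negPf b'0) (negPf t0) !orbF => /eqP-> /eqP->.
  have -> : y2 = t * y3 by apply: (mulfI b'0); rewrite h4; ring.
  transitivity (ct * (t - 1) * y3); first by ring.
  by rewrite hp; ring.
exists 0, t, 1, 0; split.
  rewrite /comm_mx /core3 /coherence !mul_op4.
  rewrite !(mul0r, mulr0, mul1r, mulr1, addr0, add0r).
  congr op4; rewrite 1?mulrC //.
  by rewrite mulrAC tt mul1r.
apply: contraNneq g0 => h; apply/eqP; rewrite -h; ring.
Qed.

Lemma core3_of_locks L z : L \is normalmx -> z != 0 -> w != 0 ->
  comm_mx L (coherence (t * z * ct) (t * z * w) (z * w) (- (ct * z))) ->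
  (forall x1 x2, comm_mx L (coherence x1 x2 0 0) -> x2 = 0) ->
  exists a b b' d, [/\ L = F3 *m core3 t a b b' d *m F3^t*,
    normal_block a b b' d & b != 0].
Proof.
move=> nL z0 w0 cL hA; have uT := frame_unitary unitary22_Ttheta.
have eX : coherence (t * z * ct) (t * z * w) (z * w) (- (ct * z)) =
    F3 *m (z *: coherence 0 t 1 0) *m F3^t*.
  by rewrite scale_coherence frame_coherence ctN ctR conjCK; congr coherence; ring.
have cM : comm_mx (F3^t* *m L *m F3) (coherence 0 t 1 0).
  move: cL; rewrite eX -{1}(unitary_conjK L uT) => /(comm_mx_unitary_conj _ _ uT).
  by move=> /(comm_mxZ z^-1); rewrite scalerA mulVf ?scale1r.
have [a [b [b' [d [eM nb]]]]] := core3_of_comm t0 tt (normal_unitary_conj uT nL) cM.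
have eL : L = F3 *m core3 t a b b' d *m F3^t* by rewrite -eM unitary_conjK.
(* If b = 0 the core is diag(a, d, a, d) and commutes with |00><10|, which the frame turns into
   [coherence ct w 0 0]; then [hA] gives w = 0. *)
exists a, b, b', d; split=> //; apply: contraNneq w0 => b0.
have /eqP b'0 : b' == 0 by rewrite -(normal_block0 nb) b0.
apply/eqP/(hA ct).
have -> : coherence ct w 0 0 = F3 *m coherence 0 1 0 0 *m F3^t*.
  by rewrite frame_coherence ctR conjCK; congr coherence; ring.
rewrite eL; apply/(comm_mx_unitary_conj _ _ uT).
rewrite b0 b'0 /comm_mx /core3 /coherence !mul_op4.
by rewrite !(mul0r, mulr0, mul1r, mulr1, addr0, add0r).
Qed.
End Core3.

(** * Rescaling the Lindblad operator by a scalar *)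

Section Scaling.
Variable C : numClosedFieldType.
Implicit Types (u : C) (L T : 'M[C]_(2 * 2)).

Lemma locks_scale u L e : u != 0 -> locks (u *: L) e <-> locks L e.
Proof.
move=> u0.
have h X : (u *: L) *m X = X *m (u *: L) <-> L *m X = X *m L.
  rewrite -scalemxAl -scalemxAr; split=> [|-> //].
  by move/(congr1 ( *:%R u^-1)); rewrite !scalerA mulVf // !scale1r.
by split=> -[h1 [x1 [x2 [x3 [x4 [cx g]]]]]]; (split;
  first by move=> ? ? ? ? /h; exact: h1); exists x1, x2, x3, x4; split=> //;
  apply/h.
Qed.

Lemma normal_block_scale u (a b b' d : C) : normal_block a b b' d ->
  normal_block (u * a) (u * b) (u * b') (u * d).
Proof.
move=> [h1 h2]; split.
  have e x : u * x * (u * x)^* = u * u^* * (x * x^*) by rewrite rmorphM /=; ring.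
  by rewrite !e h1.
rewrite -mulrBr !rmorphM /=.
transitivity (u * u^* * ((a - d) * b'^* )); first by ring.
by rewrite h2; ring.
Qed.

Lemma scale_conj_core1 u T (c a b b' d : C) :
  u *: (T *m core1 c a b b' d *m T^t*) =
  T *m core1 (u * c) (u * a) (u * b) (u * b') (u * d) *m T^t*.
Proof. by rewrite scalemxAl scalemxAr /core1 scale_op4 !mulr0. Qed.

Lemma scale_conj_core2 u T (c a b b' d : C) :
  u *: (T *m core2 c a b b' d *m T^t*) =
  T *m core2 (u * c) (u * a) (u * b) (u * b') (u * d) *m T^t*.
Proof. by rewrite scalemxAl scalemxAr /core2 scale_op4 !mulr0. Qed.

Lemma unit_phase (c : C) : exists u : C, `|u| = 1 /\ u * c \is Num.real.
Proof.
have [->|c0] := eqVneq c 0; first by exists 1; rewrite normr1 mulr0 real0.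
exists (c^* / `|c|); rewrite normrM normfV normr_id norm_conjC divff ?normr_eq0 //.
by rewrite mulrAC -normCKC expr2 mulfK ?normr_eq0 ?normr_real.
Qed.
End Scaling.

(** * Phases *)

Section Expi.
Variable R : realType.
Local Notation rc := (real_complex R).

Lemma conj_rc (x : R) : (rc x)^* = rc x.
Proof. by apply: CrealP; apply/complex_realP; exists x. Qed.

Lemma expiE (x : R) : expi x = rc (cos x) + 'i * rc (sin x).
Proof. by rewrite -complexiE [LHS]complexE. Qed.

Lemma expiD (x y : R) : expi (x + y) = expi x * expi y.
Proof.
rewrite !expiE cosD sinD !(rmorphB, rmorphD, rmorphM) /=.
have i2 : 'i * 'i = -1 :> R[i] by rewrite -expr2 sqrCi.
set c := rc (cos x); set s := rc (sin x); set c' := rc (cos y); set s' := rc (sin y).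
transitivity (c * c' + 'i * 'i * (s * s') + 'i * (s * c' + c * s')); last by ring.
by rewrite i2; ring.
Qed.

Lemma expiN (x : R) : expi (- x) = (expi x)^*.
Proof.
rewrite !expiE cosN sinN rmorphD rmorphM /= !conj_rc conjCi rmorphN /=; ring.
Qed.

Lemma expi0 : expi 0 = 1 :> R[i].
Proof. by rewrite expiE cos0 sin0 mulr0 addr0. Qed.

Lemma expiNM (x : R) : (expi x)^* * expi x = 1.
Proof. by rewrite -expiN -expiD addNr expi0. Qed.

Lemma expi_neq0 (x : R) : expi x != 0.
Proof.
by apply/eqP => h; move: (expiNM x); rewrite h mulr0 => /esym/eqP; rewrite oner_eq0.
Qed.

Lemma unit_expi (z : R[i]) : z^* * z = 1 -> exists x, z = expi x.
Proof.
case: z => a b h.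
have hab : a ^+ 2 + b ^+ 2 = 1.
  by case: h => <- _; ring.
have ha : -1 <= a <= 1.
  by rewrite -ler_norml -(@expr_le1 _ 2) ?normr_ge0 // real_normK ?num_real // -hab lerDl sqr_ge0.
have hs : Num.sqrt (1 - a ^+ 2) = `|b|.
  by rewrite -hab addrC addKr sqrtr_sqr.
have hc : cos (acos a) = a by rewrite acosK.
have [b0|b0] := lerP 0 b.
  by exists (acos a); rewrite /expi hc sin_acos // hs ger0_norm.
exists (- acos a); rewrite /expi cosN sinN hc sin_acos // hs ltr0_norm //.
by rewrite opprK.
Qed.

Lemma unit_expi2 (z : R[i]) : z^* * z = 1 -> exists x, z = expi (2 * x).
Proof.
by move=> /unit_expi[x ->]; exists (x / 2); rewrite mulrC divfK ?pnatr_eq0.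
Qed.

(** For b nonzero, 2k is the argument of b' / b^*, and the second normality relation makes (d - a)
    e^{-ik} real. For b = 0, k comes from the phase of d - a instead. *)
Lemma normal_block_expi (a b b' d : R[i]) : normal_block a b b' d ->
  exists k m, b' = expi (2 * k) * b^* /\ d = a + rc m * expi k.
Proof.
move=> nb; have bb' := normal_block0 nb; case: nb => h1 h2.
have [b0|b0] := eqVneq b 0.
  have /eqP b'0 : b' == 0 by rewrite -bb' b0.
  have [u [u1 /complex_realP[m hm]]] := unit_phase (d - a).
  have uu : u^* * u = 1 by rewrite -normCKC u1 expr1n.
  have [k hk] : exists k, u^* = expi k by apply: unit_expi; rewrite conjCK mulrC.
  exists k, m; rewrite b0 b'0 conjC0 mulr0; split=> //.
  by rewrite -hk -hm mulrAC [u * _]mulrC uu mul1r addrC subrK.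
have bc0 : b^* != 0 by rewrite conjC_eq0.
have [k hk] : exists k, b' / b^* = expi (2 * k).
  apply: unit_expi2; rewrite rmorphM fmorphV /= conjCK.
  transitivity (b' * b'^* / (b * b^* )); first by field; rewrite b0 bc0.
  by rewrite -h1 divff // mulf_neq0.
have hb' : b' = expi (2 * k) * b^* by rewrite -hk divfK.
have := expiNM k; set E := expi k => EE.
have hb'' : b' = E * E * b^* by rewrite hb' mulr2n mulrDl mul1r expiD.
have : (d - a) * E^* \is Num.real.
  apply/CrealP; rewrite rmorphM /= conjCK.
  apply: (mulIf b0).
  move: h2; rewrite hb'' !rmorphM /= conjCK => h2.
  have e : (d - a)^* * b = (d - a) * (E^* * E^* * b).
    by rewrite -[(d - a)]opprB rmorphN /= mulNr -h2; ring.
  transitivity (E * ((d - a)^* * b)); first by ring.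
  rewrite e; transitivity ((d - a) * E^* * b * (E^* * E)); first by ring.
  by rewrite EE mulr1.
move=> /complex_realP[m hm]; exists k, m; split=> //.
by rewrite -hm -mulrA EE mulr1 addrC subrK.
Qed.

Lemma expi_double (x : R) : expi (2 * x) = expi x * expi x.
Proof. by rewrite mulr2n mulrDl mul1r expiD. Qed.

Lemma expi_double_sub1 (x : R) : expi (2 * x) - 1 = expi x * (2 * 'i * rc (sin x)).
Proof.
transitivity (expi x * (expi x - (expi x)^* )).
  by rewrite mulrBr [_ * _^*]mulrC expiNM expi_double.
by rewrite expiE rmorphD rmorphM /= !conj_rc conjCi; ring.
Qed.

Lemma expi_double_add1 (x : R) : expi (2 * x) + 1 = expi x * (2 * rc (cos x)).
Proof.
transitivity (expi x * (expi x + (expi x)^* )).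
  by rewrite mulrDr [_ * _^*]mulrC expiNM expi_double.
by rewrite expiE rmorphD rmorphM /= !conj_rc conjCi; ring.
Qed.

(** e^{2iy} = (1 + i tan y) / (1 - i tan y) depends on tan y alone. This brings an angle into
    (-pi/2, pi/2) without changing e^{2iy}. *)
Lemma expi_double_atan_tan (x : R) : cos x != 0 -> expi (2 * atan (tan x)) = expi (2 * x).
Proof.
move=> cx.
have h y : cos y != 0 -> expi (2 * y) * (1 - 'i * rc (tan y)) = 1 + 'i * rc (tan y).
  move=> cy; have rcy : rc (cos y) != 0 by rewrite fmorph_eq0.
  apply: (mulIf rcy).
  have tc : rc (tan y) * rc (cos y) = rc (sin y) by rewrite -rmorphM /= /tan divfK.
  transitivity (expi (2 * y) * (expi y)^* ).
    rewrite (expiE y) rmorphD rmorphM /= !conj_rc conjCi -tc; ring.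
  rewrite expi_double -mulrA [_ * _^*]mulrC expiNM mulr1 expiE -tc; ring.
have ca : cos (atan (tan x)) != 0 by rewrite gt_eqF // cos_atan invr_gt0 sqrtr_gt0 ltr_pwDl ?sqr_ge0.
have := h _ ca; rewrite atanK -(h _ cx); apply: mulIf.
(* If 1 - i tan x vanished, so would 1 + i tan x, yet their sum is 2. *)
apply/eqP => e0.
have := h _ cx; rewrite e0 mulr0 => e1.
have : (1 - 'i * rc (tan x)) + (1 + 'i * rc (tan x)) = 0 by rewrite e0 -e1 addr0.
rewrite addrACA addNr addr0 => /eqP.
by rewrite (_ : 1 + 1 = 2%:R) ?pnatr_eq0.
Qed.
End Expi.

(** * The three parametrized families *)

Section Families.
Variable R : realType.
Local Notation rc := (real_complex R).
Implicit Types (phi theta k m c : R) (a b z : R[i]).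

(** The diagonal entry of [Ttheta] at |01>; the one at |10> is its conjugate. *)
Definition theta_w phi theta : R[i] := 'i * expi (- phi) * rc (sin theta).

Lemma theta_w_conj phi theta :
  (theta_w phi theta)^* = - ('i * expi phi * rc (sin theta)).
Proof.
by rewrite /theta_w !rmorphM /= conj_rc conjCi -expiN opprK; ring.
Qed.

Lemma theta_w_unit phi theta :
  (theta_w phi theta)^* * theta_w phi theta + rc (cos theta) * rc (cos theta) = 1.
Proof.
rewrite theta_w_conj /theta_w.
have -> : - ('i * expi phi * rc (sin theta)) * ('i * expi (- phi) * rc (sin theta))
  = - ('i ^+ 2) * (expi (- phi) * expi phi) * (rc (sin theta) * rc (sin theta)) by ring.
rewrite sqrCi opprK mul1r -expiD addNr expi0 mul1r -!rmorphM -rmorphD /= -!expr2.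
by rewrite addrC cos2Dsin2.
Qed.

(** Both sides equal 2 i e^{i theta} sin theta cos theta. This is the lock equation required by
    [locks_core3]. *)
Lemma theta_w_lock phi theta :
  rc (cos theta) * (expi (2 * theta) - 1) =
  expi phi * theta_w phi theta * (expi (2 * theta) + 1).
Proof.
rewrite expi_double_sub1 expi_double_add1 /theta_w.
transitivity (expi (- phi) * expi phi * ('i * rc (sin theta)) *
   (expi theta * (2 * rc (cos theta)))); last by ring.
by rewrite -expiD addNr expi0; ring.
Qed.

Lemma TthetaE phi theta : Ttheta phi theta =
  frame (theta_w phi theta) (rc (cos theta)) (- rc (cos theta)) (theta_w phi theta)^*.
Proof. by rewrite theta_w_conj. Qed.

Lemma L3_coreE theta a b k m : L3_core theta a b k m =
  core3 (expi (2 * theta)) a b (expi (2 * k) * b^* ) (a + rc m * expi k).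
Proof. by rewrite /core3 -expiN -mulNr mulrA. Qed.

Lemma lock_angle phi (x1 x2 x3 x4 : R[i]) :
  x1 * x3 + x2 * x4 = 0 ->
  x1 * x1^* + x2 * x2^* = x3 * x3^* + x4 * x4^* ->
  x1 + x4 = expi phi * (x2 + x3) -> x2 + x3 != 0 ->
  exists theta z, [/\ - (pi / 2) < theta < 0 \/ 0 < theta < pi / 2, z != 0,
    theta_w phi theta != 0 & coherence x1 x2 x3 x4 =
     let t := expi (2 * theta) in let ct := rc (cos theta) in
     let w := theta_w phi theta in
     coherence (t * z * ct) (t * z * w) (z * w) (- (ct * z))].
Proof.
move=> ip nvw f g0; have e0 := expi_neq0 phi.
have n0 (x y : R[i]) : x * x^* + y * y^* = 0 -> x = 0.
  move/eqP; rewrite -!normCK paddr_eq0 ?exprn_ge0 // !sqrf_eq0 !normr_eq0.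
  by case/andP => /eqP.
have x40 : x4 != 0.
  apply/eqP => x40; move: ip; rewrite x40 mulr0 addr0 => /eqP.
  rewrite mulf_eq0 => /orP[/eqP x10|/eqP x30].
    by move/eqP: f; rewrite x10 x40 addr0 eq_sym mulf_eq0 (negPf e0) (negPf g0).
  move: nvw; rewrite x30 x40 !mul0r addr0 addrC => /n0 x20.
  by move: g0; rewrite x20 x30 addr0 eqxx.
have x30 : x3 != 0.
  apply/eqP => x30; move: ip; rewrite x30 mulr0 add0r => /eqP.
  rewrite mulf_eq0 (negPf x40) orbF => /eqP x20.
  by move: g0; rewrite x20 x30 addr0 eqxx.
(* Orthogonality makes (x1, x2) equal to t (-x4, x3), and equality of norms gives |t| = 1. *)
pose t := x2 / x3.
have ex2 : x2 = t * x3 by rewrite divfK.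
have ex1 : x1 = - (t * x4).
  apply: (mulIf x30); apply/eqP; rewrite -subr_eq0; apply/eqP.
  rewrite -[RHS]ip ex2; ring.
have N0 : x3 * x3^* + x4 * x4^* != 0 by apply: contraNneq x30 => /n0 ->.
have tt : t^* * t = 1.
  apply: (mulIf N0); rewrite mul1r -{2}nvw ex1 ex2 !rmorphN !rmorphM /=; ring.
have [k hk] := unit_expi2 tt.
(* cos k = 0 would mean t = -1, hence x2 + x3 = 0. *)
have ck0 : cos k != 0.
  apply: contraNneq g0 => ck; rewrite ex2 -{2}[x3]mul1r -mulrDl hk.
  by rewrite expi_double_add1 ck /= !mulr0 mul0r.
pose theta := atan (tan k).
have ht : t = expi (2 * theta) by rewrite hk expi_double_atan_tan.
have ct0 : rc (cos theta) != 0.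
  by rewrite fmorph_eq0 gt_eqF // cos_atan invr_gt0 sqrtr_gt0 ltr_pwDl ?sqr_ge0.
(* theta = 0 would mean t = 1, so x1 + x4 = 0 and the lock equation would give x3 = 0. *)
have th0 : theta != 0.
  apply/eqP => th0; move/eqP: f; rewrite ex1 ex2 ht th0 mulr0 expi0 !mul1r addNr.
  rewrite eq_sym mulf_eq0 (negPf e0) /= -mulr2n -mulr_natr mulf_eq0 (negPf x30).
  by rewrite pnatr_eq0.
have hw := theta_w_lock phi theta; rewrite -ht in hw.
have et10 : expi phi * (t + 1) != 0.
  apply: mulf_neq0 => //; apply: contraNneq g0 => t1.
  by rewrite ex2 -{2}[x3]mul1r -mulrDl t1 mul0r.
(* The lock equation now reads - x4 (t - 1) = e^{i phi} (t + 1) x3; comparison with [theta_w_lock]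
   yields x3, and z = - x4 / cos theta. *)
have ex3 : x3 = - x4 / rc (cos theta) * theta_w phi theta.
  apply: (mulfI et10).
  transitivity (- x4 / rc (cos theta) * (rc (cos theta) * (t - 1))).
    have -> : - x4 / rc (cos theta) * (rc (cos theta) * (t - 1)) = x1 + x4.
      by rewrite ex1; field.
    by rewrite f ex2; ring.
  by rewrite hw; ring.
exists theta, (- x4 / rc (cos theta)); split.
- have := atan_gtNpi2 (tan k); have := atan_ltpi2 (tan k); rewrite -/theta.
  by case: (ltgtP theta 0) th0 => [lt0|gt0|//] _ h1 h2; [left|right]; apply/andP.
- by rewrite mulf_neq0 ?oppr_eq0 ?invr_eq0.
- by apply: contraNneq x30 => w0; rewrite ex3 w0 mulr0.
rewrite /= -ht -ex3 mulrC -mulrA -ex3; congr coherence.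
- by rewrite ex1; field.
- by rewrite ex2; ring.
- by field.
Qed.

Let sg : R[i] := rc (Num.sqrt 2)^-1.

Let sgR : sg^* = sg. Proof. exact: conj_rc. Qed.

Let sg2 : 2 * (sg * sg) = 1.
Proof.
have s2 : (Num.sqrt 2 : R) * Num.sqrt 2 = 2 by rewrite -expr2 sqr_sqrtr.
rewrite /sg -rmorphM /= -invfM s2 fmorphV /= rmorph_nat.
by rewrite divff ?pnatr_eq0.
Qed.

Lemma expi_neq_addr a m k : (a + rc m * expi k != a) = (m != 0).
Proof.
by rewrite -subr_eq0 addrC addKr mulf_eq0 (negPf (expi_neq0 k)) orbF fmorph_eq0.
Qed.

Lemma expi_conj_eq0 b k : (b == 0) = (expi (2 * k) * b^* == 0).
Proof. by rewrite mulf_eq0 (negPf (expi_neq0 _)) conjC_eq0. Qed.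

Lemma T1E phi : T1 phi = frame sg sg (expi phi * sg) (- (expi phi * sg)).
Proof. by []. Qed.

Lemma T2E phi : T2 phi = frame sg sg (- (expi phi * sg)) (expi phi * sg).
Proof. by []. Qed.

Lemma L1_coreE a b c k m : L1_core a b c k m =
  core1 (rc c) a b (expi (2 * k) * b^* ) (a + rc m * expi k).
Proof. by []. Qed.

Lemma L2_coreE a b c k m : L2_core a b c k m =
  core2 (rc c) a b (expi (2 * k) * b^* ) (a + rc m * expi k).
Proof. by []. Qed.

Lemma locks_L1 phi a b c k m : locks (T1 phi *m L1_core a b c k m *m (T1 phi)^t* )
  (expi phi) <-> b <> 0 \/ (a <> rc c /\ m <> 0).
Proof.
have := locks_core1 sgR sg2 (expiNM phi) (rc c) a (a + rc m * expi k)
  (expi_conj_eq0 b k).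
rewrite expi_neq_addr => ->; split=> -[/eqP|[/eqP h1 /eqP h2]]; by auto.
Qed.

Lemma locks_L2 phi a b c k m : locks (T2 phi *m L2_core a b c k m *m (T2 phi)^t* )
  (expi phi) <-> b <> 0 \/ (a + rc m * expi k <> rc c /\ m <> 0).
Proof.
have := locks_core2 sgR sg2 (expiNM phi) (rc c) a (a + rc m * expi k)
  (expi_conj_eq0 b k).
rewrite expi_neq_addr => ->; split=> -[/eqP|[/eqP h1 /eqP h2]]; by auto.
Qed.

Lemma locks_L3 phi theta a b k m :
  (- (pi / 2) < theta < 0) \/ (0 < theta < pi / 2) -> b <> 0 ->
  locks (Ttheta phi theta *m L3_core theta a b k m *m (Ttheta phi theta)^t* )
    (expi phi).
Proof.
move=> hth /eqP b0; rewrite TthetaE L3_coreE.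
(* On the allowed range cos theta and sin theta are nonzero, and w (t + 1) is their product up to
   nonzero factors. *)
have c0 : cos theta != 0.
  rewrite gt_eqF // cos_gt0_pihalf //; have p0 : 0 < pi / 2 :> R by rewrite divr_gt0 ?pi_gt0.
  by case: hth => /andP[h1 h2]; rewrite ?h1 ?h2 /= ?(lt_trans h2) ?(lt_trans _ h1) // oppr_lt0.
have s0 : sin theta != 0.
  have p0 : pi / 2 <= pi :> R by rewrite ler_pdivrMr // ler_peMr ?pi_ge0 // ler1n.
  case: hth => /andP[h1 h2]; last first.
    by rewrite gt_eqF // sin_gt0_pi // h1 (lt_le_trans h2).
  rewrite -oppr_eq0 -sinN gt_eqF // sin_gt0_pi // oppr_gt0 h2 /=.
  by rewrite (lt_le_trans _ p0) // ltrNl.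
apply: (locks_core3 (conj_rc _) (theta_w_unit _ _) (expiNM _)) => //.
- by rewrite -expi_conj_eq0.
- exact: theta_w_lock.
rewrite expi_double_add1 /theta_w !mulf_neq0 ?expi_neq0 ?neq0Ci ?pnatr_eq0 ?fmorph_eq0 //.
Qed.

(** In forms (1) and (2) the phase u makes c real; in form (3) u = 1 serves. The side conditions of
    forms (1) and (2) are left to the equivalences [locks_L1] and [locks_L2]. *)
Lemma locks_cases (L : op2 R) phi : L \is normalmx -> locks L (expi phi) ->
  exists u : R[i], `|u| = 1 /\
    [\/ (exists (a b : R[i]) (c k m : R),
           u *: L = T1 phi *m L1_core a b c k m *m (T1 phi)^t*),
        (exists (a b : R[i]) (c k m : R),
           u *: L = T2 phi *m L2_core a b c k m *m (T2 phi)^t*)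
      | (exists (theta : R) (a b : R[i]) (k m : R),
           [/\ (- (pi / 2) < theta < 0) \/ (0 < theta < pi / 2),
               b <> 0
             & u *: L = Ttheta phi theta *m L3_core theta a b k m
                        *m (Ttheta phi theta)^t*])].
Proof.
move=> nL lL; case: (lock_trichotomy nL lL) => [cL|cL|].
- have [c [a [b [b' [d [eL nb _]]]]]] := core1_of_locks sgR sg2 (expiNM phi) nL lL cL.
  have [u [u1 /complex_realP[c' hc]]] := unit_phase c.
  have [k [m [hb hd]]] := normal_block_expi (normal_block_scale u nb).
  exists u; split=> //; constructor 1; exists (u * a), (u * b), c', k, m.
  rewrite eL scale_conj_core1 hc hb hd T1E L1_coreE; reflexivity.
- have [c [a [b [b' [d [eL nb _]]]]]] := core2_of_locks sgR sg2 (expiNM phi) nL lL cL.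
  have [u [u1 /complex_realP[c' hc]]] := unit_phase c.
  have [k [m [hb hd]]] := normal_block_expi (normal_block_scale u nb).
  exists u; split=> //; constructor 2; exists (u * a), (u * b), c', k, m.
  rewrite eL scale_conj_core2 hc hb hd T2E L2_coreE; reflexivity.
case=> hA [x1 [x2 [x3 [x4 [cL ip nvw f g0]]]]].
have [theta [z [hth z0 w0 eX]]] := lock_angle ip nvw f g0.
rewrite eX /= in cL.
have [a [b [b' [d [eL nb b0]]]]] :=
  core3_of_locks (conj_rc _) (theta_w_unit _ _) (expiNM _) nL z0 w0 cL hA.
have [k [m [hb hd]]] := normal_block_expi nb.
exists 1; rewrite normr1; split=> //; constructor 3.
exists theta, a, b, k, m; split; [exact: hth|exact/eqP|].
by rewrite scale1r TthetaE L3_coreE -hb -hd.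
Qed.
End Families.
Unset Implicit Arguments.

(** * Classification of the phase-locking normal Lindblad operators *)

Theorem mainTheorem1 (R : realType) (E0 E1 : R) (hE : E0 - E1 <> 0)
    (phi : R) (hphi : 0 <= phi < 2 * pi)
    (L : op2 R) (hL : L \is normalmx) :
  enforces_phase_locking E0 E1 L phi <->
  exists u : R[i], `|u| = 1 /\
    [\/ (exists (a b : R[i]) (c k m : R),
           (b <> 0 \/ (a <> real_complex R c /\ m <> 0)) /\
           u *: L = T1 phi *m L1_core a b c k m *m (T1 phi)^t*),
        (exists (a b : R[i]) (c k m : R),
           (b <> 0 \/
              (a + real_complex R m * expi k <> real_complex R c /\ m <> 0)) /\
           u *: L = T2 phi *m L2_core a b c k m *m (T2 phi)^t*)
      | (exists (theta : R) (a b : R[i]) (k m : R),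
           [/\ (- (pi / 2) < theta < 0) \/ (0 < theta < pi / 2),
               b <> 0
             & u *: L = Ttheta phi theta *m L3_core theta a b k m
                        *m (Ttheta phi theta)^t*])].
Proof.
rewrite (enforces_phase_lockingE _ _ _ hL); split=> [lL|[u [u1 h]]].
  have [u [u1 hu]] := locks_cases hL lL; exists u; split=> //.
  have u0 : u != 0 by rewrite -normr_eq0 u1 oner_eq0.
  (* Since u L locks as well, the equivalences for forms (1) and (2) return their side conditions on
     the parameters. *)
  have luL := (locks_scale L (expi phi) u0).2 lL.
  case: hu => [[a [b [c [k [m eL]]]]]|[a [b [c [k [m eL]]]]]|h3].
  - constructor 1; exists a, b, c, k, m; split=> //.
    by apply/(locks_L1 phi a b c k m); rewrite -eL.
  - constructor 2; exists a, b, c, k, m; split=> //.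
    by apply/(locks_L2 phi a b c k m); rewrite -eL.
  by constructor 3.
have u0 : u != 0 by rewrite -normr_eq0 u1 oner_eq0.
apply/(locks_scale L (expi phi) u0).
case: h => [[a [b [c [k [m [h ->]]]]]]|[a [b [c [k [m [h ->]]]]]]|].
- exact/locks_L1.
- exact/locks_L2.
by move=> [theta [a [b [k [m [h1 h2 ->]]]]]]; exact: locks_L3.
Qed.
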